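(* Let $G$ be a finitely presented group with a surjective homomorphism $\phi\colon G\to\mathbb{Z}$. For each positive integer $i$ let $G_i=\phi^{-1}(i\mathbb{Z})$, and let $p$ be a prime. Then: 1. $\lim_{i\to\infty} d_p(G_i)/[G:G_i]$ exists; 2. this limit is positive if and only if the sequence $d_p(G_i)$ is unbounded; 3. if the limit is positive, then $G$ is large.
   Context: For a group $H$ and prime $p$, $d_p(H)$ is the dimension of $H_1(H;\mathbb{F}_p)$ over the field $\mathbb{F}_p$ of order $p$. A group is large if it has a finite index subgroup that admits a surjective homomorphism onto a free non-abelian group. *)

(* Defs.v *)
From HB Require Import structures.
From mathcomp Require Import all_boot all_order all_algebra.
From mathcomp Require Import finmap.
From mathcomp.multinomials Require Import freeg.
From mathcomp Require Import mathcomp_extra boolp classical_sets functions.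
From mathcomp Require Import cardinality reals topology normedtype sequences.

Set Implicit Arguments.
Unset Strict Implicit.
Unset Printing Implicit Defensive.

Import Order.TTheory GRing.Theory Num.Theory.

Local Open Scope classical_set_scope.
Local Open Scope ring_scope.

(* Groups are MathComp's possibly infinite [groupType]s; a homomorphism is
   [{hom G -> H}] (preserving the product and 1), and the infinite cyclic group is
   [Algebra.to_multiplicative int]. *)
Notation "{ 'hom' G -> H }" := (UMagmaMorphism.type G%type H%type)
  (at level 0, G at level 98, H at level 99,
   format "{ 'hom'  G  ->  H }") : type_scope.

Section Subgroup.
Local Open Scope group_scope.
Context {G : groupType}.

Record subgroup_of (S : groupClosed G) :=
  InSubgroup { subgroup_val : G ; subgroup_valP : subgroup_val \in S }.

HB.instance Definition _ (S : groupClosed G) :=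
  [isSub for @subgroup_val S].
HB.instance Definition _ (S : groupClosed G) :=
  [Choice of subgroup_of S by <:].

Lemma groupClosed_closed (S : groupClosed G) : group_closed S.
Proof. by split; [exact: gpred1 | exact: gpredF]. Qed.

HB.instance Definition _ (S : groupClosed G) :=
  SubChoice_isSubGroup.Build G (fun x => x \in S) (subgroup_of S)
    (groupClosed_closed S).

(* The set of left cosets x S. *)
Definition lcosets (S : groupClosed G) : set (set G) :=
  [set [set y | x^-1 * y \in S] | x in [set: G]].

Definition finite_index (S : groupClosed G) : Prop := finite_set (lcosets S).

(* [G : S], with the value 0 when the index is infinite. *)
Definition gindex (S : groupClosed G) : nat := #|` fset_set (lcosets S)|.

End Subgroup.

Section FreeGroup.
Context {X : choiceType}.

(* The letter (x, true) stands for x and (x, false) for its inverse. *)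
Definition letter : Type := (X * bool)%type.
Definition linv (a : letter) : letter := (a.1, ~~ a.2).
Arguments linv : simpl never.

Lemma linvK : involutive linv.
Proof. by case=> x b; rewrite /linv /= negbK. Qed.

Definition reduced_word (w : seq letter) : bool :=
  sorted (fun a b => b != linv a) w.

(* The reduced form of a :: w, for w a reduced word. *)
Definition lcons (a : letter) (w : seq letter) : seq letter :=
  if w is b :: w' then if b == linv a then w' else a :: w else [:: a].

Lemma lcons_reduced a w : reduced_word w -> reduced_word (lcons a w).
Proof.
case: w => [|b w] //= bw; case: ifPn => [_|ab] /=; first exact: path_sorted bw.
by rewrite ab.
Qed.

Lemma lconsK a w : reduced_word w -> lcons a (lcons (linv a) w) = w.
Proof.
case: w => [|b w] /=; first by rewrite eqxx.
rewrite linvK; case: eqVneq => [->|ba] /=; last by rewrite eqxx.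
by case: w => [|c w] //= /andP[/negPf ->].
Qed.

Lemma lcons_id a w : reduced_word (a :: w) -> lcons a w = a :: w.
Proof. by case: w => [|b w] //= /andP[/negPf ->]. Qed.

Definition word_mul (u v : seq letter) : seq letter := foldr lcons v u.
Definition word_inv (u : seq letter) : seq letter := rev (map linv u).

Lemma word_mul_reduced u v : reduced_word v -> reduced_word (word_mul u v).
Proof. by move=> rv; elim: u => //= a u; exact: lcons_reduced. Qed.

Lemma word_mul1 u : reduced_word u -> word_mul u [::] = u.
Proof.
elim: u => //= a u IHu rau.
by rewrite IHu ?lcons_id //; exact: path_sorted rau.
Qed.

Lemma word_mul_lcons a t w : reduced_word w ->
  word_mul (lcons a t) w = lcons a (word_mul t w).
Proof.
move=> rw; case: t => [|b t] //=; case: eqVneq => [->|_] //=.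
by rewrite lconsK //; exact: word_mul_reduced.
Qed.

Lemma word_mulA u v w : reduced_word w ->
  word_mul u (word_mul v w) = word_mul (word_mul u v) w.
Proof. by move=> rw; elim: u => //= a u IHu; rewrite word_mul_lcons // IHu. Qed.

Lemma word_inv_reduced u : reduced_word u -> reduced_word (word_inv u).
Proof.
rewrite /reduced_word /word_inv rev_sorted sorted_map => ru.
by apply: sub_sorted ru => a b /=; rewrite linvK eq_sym.
Qed.

Lemma word_invK : involutive word_inv.
Proof. by move=> u; rewrite /word_inv map_rev revK mapK //; exact: linvK. Qed.

Lemma word_mulVw u : reduced_word u -> word_mul (word_inv u) u = [::].
Proof.
elim: u => //= a u IHu rau.
rewrite /word_inv /= rev_cons /word_mul foldr_rcons /= linvK eqxx.
by apply: IHu; exact: path_sorted rau.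
Qed.

End FreeGroup.

(* The free group on X: reduced words in the letters x and x^-1, multiplied by
   concatenation followed by free reduction. *)
Record freegroup (X : choiceType) :=
  FreeGroup { fgword : seq (@letter X) ; fgwordP : reduced_word fgword }.

Section FreeGroupInstances.
Context {X : choiceType}.

HB.instance Definition _ := [isSub for @fgword X].
HB.instance Definition _ := [Choice of freegroup X by <:].

Implicit Types u v w : freegroup X.

Definition fg_one : freegroup X := @FreeGroup X [::] isT.
Definition fg_mul u v : freegroup X :=
  FreeGroup (word_mul_reduced (fgword u) (fgwordP v)).
Definition fg_inv u : freegroup X := FreeGroup (word_inv_reduced (fgwordP u)).

Lemma fg_mulA : associative fg_mul.
Proof. by move=> u v w; apply/val_inj/word_mulA/fgwordP. Qed.

Lemma fg_mul1g : left_id fg_one fg_mul.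
Proof. by move=> u; apply/val_inj. Qed.

Lemma fg_mulg1 : right_id fg_one fg_mul.
Proof. by move=> u; apply/val_inj/word_mul1/fgwordP. Qed.

Lemma fg_mulVg : left_inverse fg_one fg_inv fg_mul.
Proof. by move=> u; apply/val_inj/word_mulVw/fgwordP. Qed.

Lemma fg_mulgV : right_inverse fg_one fg_inv fg_mul.
Proof.
move=> u; apply/val_inj => /=; rewrite -{1}[fgword u]word_invK.
exact/word_mulVw/word_inv_reduced/fgwordP.
Qed.

HB.instance Definition _ := isMonoid.Build (freegroup X)
  fg_mulA fg_mul1g fg_mulg1.
HB.instance Definition _ := hasInv.Build (freegroup X) fg_inv.
HB.instance Definition _ := Monoid_isGroup.Build (freegroup X)
  fg_mulVg fg_mulgV.

End FreeGroupInstances.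

Definition surjective (A B : Type) (f : A -> B) : Prop :=
  forall y, exists x, f x = y.

Section GroupProperties.
Local Open Scope group_scope.

Definition normal_closure (G : groupType) (A : set G) : set G :=
  [set x | forall N : groupClosed G,
     (forall y z, y \in N -> y ^ z \in N) ->
     (forall y, A y -> y \in N) -> x \in N].

(* G is the quotient of a free group of finite rank n by the normal closure of
   a finite set r of relators. *)
Definition finitely_presented (G : groupType) : Prop :=
  exists (n : nat) (r : seq (freegroup 'I_n))
         (f : {hom freegroup 'I_n -> G}),
    surjective f /\ [set w | f w = 1] = normal_closure [set` r].

Definition large (G : groupType) : Prop :=
  exists (S : groupClosed G) (X : choiceType)
         (f : {hom subgroup_of S -> freegroup X}),
    [/\ finite_index S, (exists x y : freegroup X, ~ commute x y) &
        surjective f].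

End GroupProperties.

Section Subquotient.
Context {F : fieldType} {V : lmodType F}.

(* For subspaces B `<=` Z of V, the classes of the b i form a basis of the
   quotient space Z / B. *)
Definition basis_mod (Z B : set V) (n : nat) (b : 'I_n -> V) : Prop :=
  [/\ forall i, Z (b i),
      forall a : 'I_n -> F, B (\sum_i a i *: b i) -> forall i, a i = 0 &
      forall z, Z z -> exists a : 'I_n -> F, B (z - \sum_i a i *: b i)].

(* dim (Z / B), with the value 0 when the quotient is infinite-dimensional. *)
Definition dim_mod (Z B : set V) : nat :=
  xget 0%N [set n | exists b : 'I_n -> V, basis_mod Z B b].

End Subquotient.

(* H_1(H; F) for trivial coefficients F, computed from the unnormalised
   inhomogeneous bar complex  F[H x H] -> F[H] -> F. *)
Section Homology.
Context (F : fieldType) (H : groupType).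

Definition bar_d1 : {freeg H / F} -> F^o := fglift (fun _ : H => 1 - 1 : F^o).

Definition bar_d2 : {freeg (H * H)%type / F} -> {freeg H / F} :=
  fglift (fun gh : H * H =>
    [freeg [:: (1 : F, gh.2)]] - [freeg [:: (1 : F, (gh.1 * gh.2)%g)]]
    + [freeg [:: (1 : F, gh.1)]]).

Definition dim_H1 : nat :=
  dim_mod [set z | bar_d1 z = 0] [set bar_d2 c | c in setT].

End Homology.

(* d_p(H); only meaningful for p prime, when 'F_p has order p. *)
Definition d_ (p : nat) (H : groupType) : nat := dim_H1 'F_p H.

Section CyclicCovers.
Context {G : groupType} (phi : {hom G -> Algebra.to_multiplicative int}).

(* phi^-1(i Z) *)
Definition preim_mulz (i : nat) : {pred G} :=
  [pred g | (i%:Z %| (phi g : int))%Z].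

Fact preim_mulz_mul i : mulg_closed (preim_mulz i).
Proof. by move=> x y; rewrite !inE gmulfM; exact: rpredD. Qed.
Fact preim_mulz_one i : 1%g \in preim_mulz i.
Proof. by rewrite inE gmulf1; exact: rpred0. Qed.
Fact preim_mulz_inv i : invg_closed (preim_mulz i).
Proof. by move=> x; rewrite !inE gmulfV => h; rewrite rpredN. Qed.

HB.instance Definition _ i := isMulClosed.Build G (preim_mulz i)
  (@preim_mulz_mul i).
HB.instance Definition _ i := isMul1Closed.Build G (preim_mulz i)
  (@preim_mulz_one i).
HB.instance Definition _ i := isInvClosed.Build G (preim_mulz i)
  (@preim_mulz_inv i).

End CyclicCovers.

(* Main.v *)
Require Import Defs.
From HB Require Import structures.
From mathcomp Require Import all_boot all_order all_algebra.
From mathcomp Require Import zify ring lra.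
From mathcomp Require Import perm.
From mathcomp.multinomials Require Import freeg.
From mathcomp Require Import mathcomp_extra boolp classical_sets functions.
From mathcomp Require Import cardinality reals topology normedtype sequences.
Set Implicit Arguments.
Unset Strict Implicit.
Unset Printing Implicit Defensive.
Import Order.TTheory GRing.Theory Num.Theory.
Import numFieldNormedType.Exports.
Local Open Scope classical_set_scope.
Local Open Scope ring_scope.

(** Fix t in G with phi t = 1 and let M be the kernel of phi, F the field of order
    p. The group phi^-1(iZ) is generated by M and t^i, and d_p(G_i) is the
    dimension of its space of homomorphisms to F ([dim_H1_addhom]); up to the
    value at t^i these are the homomorphisms M -> F that are invariant under
    conjugation by t^i. A homomorphism c : M -> F is the same thing as a derivation
    d : G -> F^Z with d t = 0, by d g k = c (t^k g t^(-k - phi g)), and invariance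
    under t^i means that the sequences d g have period i ([addhom_per],
    [per_addhom]). A derivation is determined by its sequences on the generators,
    and since G is finitely presented, a choice of such sequences comes from a
    derivation if and only if it looks so through all windows of some fixed length
    l ([tder_glue]): Hom(M, F) is a linear subshift of finite type.

    Let s N be the dimension of the space of derivations whose sequences on the
    generators are supported in [0, N). Cutting a periodic derivation to one
    period, or repeating a supported one, is possible as soon as it vanishes on a
    window of length l, which is a bounded number of linear conditions. Hence
    d_p(G_i) and s i differ by a bounded amount ([homology_growth]). Supported
    derivations can be placed side by side, so s is superadditive, s N / N tends to
    its supremum, and so does d_p(G_i) / i ([growth_cvg]). If this supremum is
    zero, s vanishes and d_p(G_i) is bounded; otherwise s N > 0 for some N, and
    then s (q N) >= q for all q ([growth_pos]).

    In the latter case there is a nonzero finitely supported derivation d, that is,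
    a homomorphism g |-> (d g, phi g) from G to the lamplighter group, whose image
    contains the generator of Z and some nonzero configuration of lamps. That
    group is a limit of virtually free groups, obtained by keeping only the
    relations between lamps at distance at most K, and the finitely many relators
    of G only use finitely many of its relations; so G maps to the K-th of these
    groups for K large ([near_model]). Concretely, 3K+1 lamps are placed on a cycle,
    the generator of Z rotates them, and each rotation carries a label in the free
    group on x and y that depends only on K of the lamps, which are never switched
    directly. The label is x if these lamps show the front edge of a configuration
    that is passing, and y otherwise. The dark configuration has finite orbit, t is
    a loop there with label y, and switching lamps on, making a full turn and
    switching them off is a loop with label y^a x y^b ([full_turn]). Hence the
    labels map the stabiliser of the dark configuration, a subgroup of finite
    index, onto the free group ([large_of_tder]). *)

(** * Subgroups, homomorphisms and integer powers *)

Section GroupTools.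
Local Open Scope group_scope.

Lemma morph1_of (A B : groupType) (h : A -> B) :
  {morph h : x y / x * y} -> h 1 = 1.
Proof. by move=> hM; apply: (mulgI (h 1)); rewrite -hM !mulg1. Qed.

Definition mk_hom (A B : groupType) (h : A -> B)
    (hM : {morph h : x y / x * y}) : {hom A -> B} :=
  HB.pack h (isMultiplicative.Build A B h hM)
    (Multiplicative_isUMagmaMorphism.Build A B h (morph1_of hM)).

Section MkSubgroup.
Variables (G : groupType) (P : set G).
Hypothesis P1 : P 1.
Hypothesis PM : forall x y, P x -> P y -> P (x * y).
Hypothesis PV : forall x, P x -> P x^-1.

Let S : {pred G} := [pred x | `[< P x >]].

Let SM : mulg_closed S.
Proof. by move=> x y /asboolP Px /asboolP Py; apply/asboolP/PM. Qed.
Let S1 : 1 \in S. Proof. exact/asboolP. Qed.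
Let SV : invg_closed S.
Proof. by move=> x /asboolP Px; apply/asboolP/PV. Qed.

Definition mk_subgroup : groupClosed G :=
  HB.pack S (isMulClosed.Build G S SM) (isMul1Closed.Build G S S1)
    (isInvClosed.Build G S SV).

Lemma mk_subgroupP x : (x \in mk_subgroup) <-> P x.
Proof. by split=> /asboolP. Qed.

End MkSubgroup.

Section IntegerPowers.
Variable G : groupType.
Implicit Types (x : G) (k l : int).

Let intS_r (n : nat) : (Posz n + 1)%R = Posz n.+1. Proof. lia. Qed.

Definition zpow x k : G := match k with Posz n => x ^+ n | Negz n => x ^- n.+1 end.

Lemma zpowS x k : zpow x (k + 1)%R = zpow x k * x.
Proof.
case: k => [n|[|n]]; first by rewrite intS_r /= expgSr.
  by rewrite /= expg1 mulVg.
have -> : (Negz n.+1 + 1)%R = Negz n by rewrite !NegzE; lia.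
by rewrite /= [x ^+ n.+2]expgS invgM mulgVK.
Qed.

Lemma zpowD x k l : zpow x (k + l)%R = zpow x k * zpow x l.
Proof.
elim/int_rect: l => [|n IHn|n IHn]; first by rewrite addr0 mulg1.
  by rewrite -intS_r addrA !zpowS IHn mulgA.
apply: (mulIg x); rewrite -mulgA -!zpowS -addrA.
by rewrite (_ : (- n.+1%:Z + 1 = - n%:Z)%R) ?IHn //; lia.
Qed.

Lemma zpow1 x : zpow x 1%R = x. Proof. by []. Qed.

Lemma zpowN x k : zpow x (- k)%R = (zpow x k)^-1.
Proof. by apply/esym/mulg1_eq; rewrite -zpowD addrN. Qed.

End IntegerPowers.
End GroupTools.

Arguments zpow : simpl never.

(** * Free groups and finite presentations *)

Section FreeGroupTheory.
Local Open Scope group_scope.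
Variable X : choiceType.

Lemma fg_letter_reduced (a : @letter X) : reduced_word [:: a]. Proof. by []. Qed.
Definition fg_letter a : freegroup X := FreeGroup (fg_letter_reduced a).
Definition fg_gen (x : X) := fg_letter (x, true).

Lemma fg_letterV x : fg_letter (x, false) = (fg_gen x)^-1.
Proof. exact/val_inj. Qed.

Lemma freegroup_ind (P : freegroup X -> Prop) :
  P 1 -> (forall x, P (fg_gen x)) ->
  (forall u v, P u -> P v -> P (u * v)) -> (forall u, P u -> P u^-1) ->
  forall w, P w.
Proof.
move=> P1 Pg PM PV [w]; elim: w => [|[x b] w IHw] rw.
  by rewrite (_ : FreeGroup rw = 1) //; exact/val_inj.
have rw' : reduced_word w by exact: path_sorted rw.
rewrite (_ : FreeGroup rw = fg_letter (x, b) * FreeGroup rw'); last first.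
  by apply/val_inj; rewrite /= lcons_id.
apply: PM => //; case: b {rw}; first exact: Pg.
by rewrite fg_letterV; exact/PV/Pg.
Qed.

Section UniversalProperty.
Variables (H : groupType) (u : X -> H).

Definition letter_val (a : @letter X) : H := if a.2 then u a.1 else (u a.1)^-1.
Definition word_val (w : seq (@letter X)) : H :=
  foldr (fun a z => letter_val a * z) 1 w.

Lemma letter_valV a : letter_val (linv a) = (letter_val a)^-1.
Proof. by case: a => x []; rewrite /letter_val //= invgK. Qed.

Lemma word_val_lcons a w : word_val (lcons a w) = letter_val a * word_val w.
Proof.
case: w => [|b w] //=; case: eqP => [->|//].
by rewrite letter_valV mulgA mulgV mul1g.
Qed.

Lemma word_valM :
  {morph (fun w : freegroup X => word_val (fgword w)) : v w / v * w}.
Proof.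
move=> [v rv] [w rw] /=; elim: v {rv} => [|a v IHv] /=; first by rewrite mul1g.
by rewrite word_val_lcons IHv mulgA.
Qed.

Definition fg_lift : {hom freegroup X -> H} := mk_hom word_valM.

Lemma fg_lift_gen x : fg_lift (fg_gen x) = u x.
Proof. exact: mulg1. Qed.

End UniversalProperty.
End FreeGroupTheory.

(** Conjugation-invariance of kernels makes a homomorphism kill the whole normal
    closure of the relators as soon as it kills them, so that it factors through
    the presented group. *)
Lemma hom_of_presentation (F G H : groupType) (r : seq F) (f : {hom F -> G})
    (h : {hom F -> H}) :
  surjective f -> [set w | f w = 1%g] = normal_closure [set` r] ->
  {in r, forall w, h w = 1%g} ->
  exists h' : {hom G -> H}, forall w, h' (f w) = h w.
Proof.
move=> fsurj kerf hr.
have K1 : [set w | h w = 1%g] 1%g by rewrite /= gmulf1.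
have KM x y : h x = 1%g -> h y = 1%g -> h (x * y)%g = 1%g.
  by move=> hx hy; rewrite gmulfM hx hy mulg1.
have KV x : h x = 1%g -> h x^-1%g = 1%g by move=> hx; rewrite gmulfV hx invg1.
pose K := mk_subgroup K1 KM KV.
have ker w : f w = 1%g -> h w = 1%g.
  have -> : (f w = 1%g) = [set w | f w = 1%g] w by [].
  rewrite kerf => /(_ K) wK; apply/(mk_subgroupP K1 KM KV); apply: wK => [y z|y yr].
    move=> /(mk_subgroupP K1 KM KV) /= hy; apply/(mk_subgroupP K1 KM KV).
    by rewrite /= gmulfJ hy conj1g.
  by apply/(mk_subgroupP K1 KM KV); exact: hr.
have hf v w : f v = f w -> h v = h w.
  move=> fvw; apply/divg1_eq; rewrite -gmulfF; apply: ker.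
  by rewrite gmulfF fvw mulgV.
pose s g := projT1 (cid (fsurj g)); have sK g : f (s g) = g by rewrite /s; case: cid.
have hsM : {morph (h \o s) : x y / (x * y)%g}.
  by move=> x y /=; rewrite -gmulfM; apply: hf; rewrite gmulfM !sK.
by exists (mk_hom hsM) => w; exact/hf/sK.
Qed.

(** * Dimensions of function spaces, by independent families *)

Section Dimension.
Variable F : fieldType.

Definition lin_closed (V : lmodType F) (U : set V) : Prop :=
  U 0 /\ forall a u v, U u -> U v -> U (a *: u + v).

Definition is_form (V : lmodType F) (f : V -> F) : Prop :=
  forall a u v, f (a *: u + v) = a * f u + f v.

Definition indep (V : lmodType F) (U : set V) (m : nat) : Prop :=
  exists b : 'I_m -> V, (forall i, U (b i)) /\
    forall a : 'I_m -> F, \sum_i a i *: b i = 0 -> forall i, a i = 0.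

(** Dimension is encoded by the sizes of independent families because the spaces
    compared below consist of functions on different infinite groups, and their
    finite-dimensionality is itself a consequence of these comparisons. *)
Definition is_dim (V : lmodType F) (U : set V) (d : nat) : Prop :=
  forall m, indep U m <-> (m <= d)%N.

Section OneSpace.
Variable V : lmodType F.
Implicit Types (U W : set V) (f : V -> F).

Lemma lin_closed_sum U m (a : 'I_m -> F) (b : 'I_m -> V) :
  lin_closed U -> (forall i, U (b i)) -> U (\sum_i a i *: b i).
Proof.
move=> [U0 UL] Ub; apply: (big_ind U) => // [x y Ux Uy|i _].
  by rewrite -[x]scale1r; exact: UL.
by rewrite -[_ *: _]addr0; exact: UL.
Qed.

Lemma form0 f : is_form f -> f 0 = 0.
Proof.
move=> fL; have := fL 1 0 0; rewrite scale1r addr0 mul1r => f00.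
by apply: (addrI (f 0)); rewrite addr0 -f00.
Qed.

Lemma form_sum f m (a : 'I_m -> F) (b : 'I_m -> V) :
  is_form f -> f (\sum_i a i *: b i) = \sum_i a i * f (b i).
Proof.
move=> fL; have fD u v : f (u + v) = f u + f v.
  by rewrite -[u]scale1r fL mul1r scale1r.
rewrite (big_morph f fD (form0 fL)); apply: eq_bigr => i _.
by rewrite -[_ *: _]addr0 fL (form0 fL) addr0.
Qed.

Lemma indep0 U : indep U 0.
Proof. by exists (fun _ => 0); split=> [[]|a _ []]. Qed.

Lemma indep_le U m m' : (m' <= m)%N -> indep U m -> indep U m'.
Proof.
move=> le_m [b [Ub bI]]; exists (b \o widen_ord le_m); split=> [i|a a0 i].
  exact: Ub.
pose a' (j : 'I_m) := if insub (val j) is Some i then a i else 0.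
have a'E (i' : 'I_m') : a' (widen_ord le_m i') = a i'.
  by rewrite /a' /= valK.
rewrite -a'E; apply: bI; rewrite -[RHS]a0 /=.
rewrite (bigID (fun j : 'I_m => (j < m')%N)) /= [X in _ + X]big1 ?addr0; last first.
  by move=> j jm; rewrite /a' insubN ?scale0r.
rewrite (big_ord_narrow le_m); apply: eq_bigr => j _.
by congr (a' _ *: b _ = _)%R || by rewrite a'E.
Qed.

Lemma dim_exists U M : (forall m, indep U m -> (m <= M)%N) -> exists d, is_dim U d.
Proof.
move=> bU; pose P m := `[< indep U m >].
have exP : exists m, P m by exists 0%N; apply/asboolP/indep0.
have bP m : P m -> (m <= M)%N by move/asboolP/bU.
case: (ex_maxnP exP bP) => d /asboolP Ud dmax; exists d => m; split.
  by move=> Um; apply: dmax; apply/asboolP.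
by move=> le_m; exact: indep_le Ud.
Qed.

(** The combinations of an independent family that satisfy the conditions form
    the left kernel of a matrix with #|I| columns. *)
Lemma indep_cut (I : finType) (ev : I -> V -> F) U m :
  lin_closed U -> (forall i, is_form (ev i)) -> indep U m ->
  indep [set u | U u /\ forall i, ev i u = 0] (m - #|I|)%N.
Proof.
move=> UL evL [b [Ub bI]].
pose A : 'M[F]_(m, #|I|) := \matrix_(i, j) ev (enum_val j) (b i).
pose N := row_base (kermx A).
have NA : N *m A = 0 by apply/sub_kermxP; rewrite eq_row_base.
have leN : (m - #|I| <= \rank (kermx A))%N.
  by rewrite mxrank_ker leq_sub2l ?rank_leq_col.
apply: (indep_le leN); exists (fun l => \sum_i N l i *: b i); split=> [l|a a0].
  split; first exact: lin_closed_sum.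
  move=> i; rewrite (form_sum _ _ (evL i)).
  have := congr1 (fun M : 'M_(_, _) => M l (enum_rank i)) NA.
  rewrite !mxE => NAl; rewrite -[RHS]NAl; apply: eq_bigr => j _.
  by rewrite [A _ _]mxE enum_rankK.
have aN : (\row_l a l) *m N = 0.
  apply/rowP => i; rewrite !mxE; move: i; apply: bI; rewrite -[RHS]a0.
  under eq_bigr => i _ do rewrite scaler_suml.
  rewrite exchange_big /=; apply: eq_bigr => l _; rewrite scaler_sumr.
  by apply: eq_bigr => i _; rewrite mxE scalerA.
move=> l; have /rowP/(_ l) : \row_l a l = 0.
  by apply: (row_free_inj (row_base_free (kermx A))); rewrite mul0mx.
by rewrite !mxE.
Qed.

Lemma indep_separated (I : finType) (ev : I -> V -> F) U m :
  lin_closed U -> (forall i, is_form (ev i)) ->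
  (forall u, U u -> (forall i, ev i u = 0) -> u = 0) ->
  indep U m -> (m <= #|I|)%N.
Proof.
move=> UL evL sep /(indep_cut UL evL); rewrite -subn_eq0.
case: (_ - _)%N => [//|k] [b [Ub bI]]; have [/sep b0 ev0] := Ub ord0.
pose e (i : 'I_k.+1) : F := (i == ord0)%:R.
have e0 : \sum_i e i *: b i = 0.
  rewrite (bigD1 ord0) //= b0 // scaler0 add0r big1 // => i /negPf i0.
  by rewrite /e i0 scale0r.
by have /eqP := bI e e0 ord0; rewrite /e eqxx oner_eq0.
Qed.

Lemma indep_sum U U' W m m' :
  lin_closed U -> lin_closed U' -> U `<=` W -> U' `<=` W ->
  (forall u u', U u -> U' u' -> u + u' = 0 -> u = 0) ->
  indep U m -> indep U' m' -> indep W (m + m').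
Proof.
move=> UL UL' UW UW' dir [b [Ub bI]] [b' [Ub' bI']].
pose c (s : 'I_m + 'I_m') := match s with inl j => b j | inr j => b' j end.
have cl j : c (fintype.split (lshift m' j)) = b j by rewrite (unsplitK (inl j)).
have cr j : c (fintype.split (rshift m j)) = b' j by rewrite (unsplitK (inr j)).
exists (fun i : 'I_(m + m') => c (fintype.split i)); split.
  by move=> i; case: (fintype.split i) => j; [exact/UW/Ub|exact/UW'/Ub'].
move=> a; rewrite big_split_ord /=.
under eq_bigr => i _ do rewrite cl.
under [X in _ + X]eq_bigr => i _ do rewrite cr.
move=> a0; have s0 := dir _ _ (lin_closed_sum _ UL Ub) (lin_closed_sum _ UL' Ub') a0.
move: a0; rewrite s0 add0r => s0'.
move=> i; rewrite -[i]splitK; case: (fintype.split i) => j.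
  exact: (bI (fun j => a (lshift m' j))).
exact: (bI' (fun j => a (rshift m j))).
Qed.

End OneSpace.

(** Spaces are compared element by element: no linear map between them has to be
    exhibited, as soon as elements correspond in such a way that a separating
    family of forms on one side takes the same values on the other. *)
Lemma indep_transfer (V V' : lmodType F) (I : Type) (ev : I -> V -> F)
    (ev' : I -> V' -> F) (U : set V) (U' : set V') m :
  lin_closed U -> (forall i, is_form (ev i)) -> (forall i, is_form (ev' i)) ->
  (forall u, U u -> (forall i, ev i u = 0) -> u = 0) ->
  (forall u, U u -> exists2 u', U' u' & forall i, ev' i u' = ev i u) ->
  indep U m -> indep U' m.
Proof.
move=> UL evL evL' sep tr [b [Ub bI]].
have /choice[b' Ub'] : forall i, exists u', U' u' /\ forall j, ev' j u' = ev j (b i).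
  by move=> i; have [u'] := tr _ (Ub i); exists u'.
exists b'; split=> [i|a a0]; first by case: (Ub' i).
apply: bI; apply: sep => [|j]; first exact: lin_closed_sum.
have := form0 (evL' j); rewrite -a0 !form_sum // => ev0; rewrite -[RHS]ev0.
by apply: eq_bigr => i _; rewrite (Ub' i).2.
Qed.

(** A submodule that is maximal among those containing B and avoiding z has the
    line spanned by z as a complement; the coordinate on this line is the form. *)
Lemma separating_form (V : lmodType F) (B : set V) (z : V) :
  lin_closed B -> ~ B z ->
  exists f : V -> F, [/\ is_form f, forall b, B b -> f b = 0 & f z = 1].
Proof.
move=> BL nBz.
pose P (C : set V) := [/\ lin_closed C, B `<=` C & ~ C z].
(* B is added so that the union of the empty chain still contains it. *)
pose P' (C : set V) := P (C `|` B).
have [C [[CL BC nCz] Cmax]] : exists A, P' A /\ forall C, A `<` C -> ~ P' C.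
  apply: Zorn_bigcup => T TP Ttot; split; first last.
  - by case=> // -[X TX Xz]; case: (TP _ TX) => _ _; apply; left.
  - by move=> v; right.
  split; first by right; case: BL.
  have up X Y v : T X -> T Y -> X `<=` Y -> (X `|` B) v -> (Y `|` B) v.
    by move=> TX TY XY [/XY|]; [left|right].
  have bigT X v : T X -> (X `|` B) v -> (\bigcup_(X in T) X `|` B) v.
    by move=> TX [Xv|]; [left; exists X|right].
  move=> a u v [[X TX Xu]|Bu] [[Y TY Yv]|Bv].
  - have [XY|YX] := Ttot _ _ TX TY.
      by apply: (bigT _ _ TY); have [[_ +] _ _] := TP _ TY; apply; left => //; exact: XY.
    by apply: (bigT _ _ TX); have [[_ +] _ _] := TP _ TX; apply; left => //; exact: YX.
  - by apply: (bigT _ _ TX); have [[_ +] _ _] := TP _ TX; apply; [left|right].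
  - by apply: (bigT _ _ TY); have [[_ +] _ _] := TP _ TY; apply; [right|left].
  - by right; apply BL.
pose D := C `|` B.
have [D0 DL] : lin_closed D := CL.
have DZ a u : D u -> D (a *: u) by move=> Du; rewrite -[_ *: _]addr0; exact: DL.
have DD u v : D u -> D v -> D (u + v).
  by move=> Du Dv; rewrite -[u]scale1r; exact: DL.
have ex v : exists a, D (v - a *: z).
  have [Dv|nDv] := pselect (D v); first by exists 0; rewrite scale0r subr0.
  pose E := [set c + a *: v | c in D & a in @setT F].
  have DE u : D u -> E u.
    by move=> Du; exists u => //; exists 0 => //; rewrite scale0r addr0.
  have Ev : E v by exists 0 => //; exists 1 => //; rewrite scale1r add0r.
  have nPE : ~ P' E.
    apply: Cmax; split=> [u Cu|]; first by apply: DE; left.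
    by move=> /(_ _ Ev) Cv; apply: nDv; left.
  have EB : E `|` B = E by rewrite setUidPl // => u Bu; apply: DE; right.
  have : E z.
    apply: contrapT => nEz; apply: nPE; rewrite /P' EB; split=> //; last first.
      by move=> u Bu; apply: DE; right.
    split; first exact: DE.
    move=> a _ _ [c Dc [k _ <-]] [c' Dc' [k' _ <-]].
    exists (a *: c + c'); first exact: DL.
    by exists (a * k + k') => //; rewrite scalerDr scalerDl -scalerA addrACA.
  case=> c Dc [a _ zE]; have a0 : a != 0.
    by apply: contra_not_neq nCz => a0; move: Dc; rewrite -zE a0 scale0r addr0.
  exists a^-1; rewrite -zE scalerDr scalerA mulVf // scale1r opprD addrCA subrr addr0.
  by rewrite -scaleN1r; exact/DZ/DZ.
have /choice[f fP] := ex.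
have uniq v a : D (v - a *: z) -> f v = a.
  move=> Dv; apply: contrapT => /eqP; rewrite -subr_eq0 => ne; apply: nCz.
  have : D ((f v - a)^-1 *: ((v - a *: z) - (v - f v *: z))).
    by apply: (DZ); apply: DD => //; rewrite -scaleN1r; exact: DZ.
  by rewrite opprB [v - _ + _]addrC subrKA -scalerBl scalerA mulVf // scale1r.
exists f; split=> [a u v|b Bb|].
- apply: uniq; have := DL a _ _ (fP u) (fP v).
  by rewrite scalerBr addrACA -opprD scalerDl scalerA.
- by apply: uniq; rewrite scale0r subr0; right.
by apply: uniq; rewrite scale1r subrr.
Qed.

End Dimension.

(** * First homology is dual to homomorphisms *)

Section HomologyDual.
Variables (F : fieldType) (H : groupType).
Implicit Types (c : H -> F^o) (D : {freeg H / F}).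

Definition addhom : set (H -> F^o) :=
  [set c | forall g h, c (g * h)%g = c g + c h].

Lemma addhom_lin : lin_closed addhom.
Proof.
split=> [g h|a u v uM vM g h]; first by rewrite addr0.
have E x : (a *: u + v) x = a *: u x + v x by [].
by rewrite !E uM vM scalerDr addrACA.
Qed.

Lemma fgliftD (K : choiceType) (M : lmodType F) (f : K -> M) :
  {morph fglift f : x y / x + y}.
Proof.
have fB := lift_is_additive f.
have f0 : fglift f 0 = 0 by have := fB 0 0; rewrite !subr0 subrr.
have fN x : fglift f (- x) = - fglift f x by rewrite -[- x]add0r fB f0 sub0r.
by move=> x y; rewrite -[y in LHS]opprK fB fN opprK.
Qed.

Lemma fglift0 (K : choiceType) (M : lmodType F) (f : K -> M) : fglift f 0 = 0.
Proof. by apply: (addrI (fglift f 0)); rewrite -fgliftD !addr0. Qed.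

Lemma fgliftZ (K : choiceType) (M : lmodType F) (f : K -> M) a x :
  fglift f (a *: x) = a *: fglift f x.
Proof.
have -> : a *: x = \sum_(z <- dom x) << a * coeff z x *g z >> by [].
rewrite -[in RHS](freeg_sumE x).
rewrite !(big_morph _ (fgliftD f) (fglift0 f)) scaler_sumr.
by apply: eq_bigr => i _; rewrite !liftU scalerA.
Qed.

Definition ext c : {freeg H / F} -> F := fglift c.

Lemma ext_form c : is_form (ext c).
Proof. by move=> a u v; rewrite /ext fgliftD fgliftZ. Qed.

Lemma extU c h : ext c << h >> = c h.
Proof. by rewrite /ext liftU scale1r. Qed.

Lemma ext_unique c (f : {freeg H / F} -> F) :
  is_form f -> (forall h, f << h >> = c h) -> f =1 ext c.
Proof.
move=> fL fc; have gL := ext_form c.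
have formD (g : {freeg H / F} -> F) : is_form g -> {morph g : x y / x + y}.
  by move=> gg x y; rewrite -[x]scale1r gg mul1r scale1r.
move=> D; rewrite -[D]freeg_sumE.
rewrite (big_morph _ (formD _ fL) (form0 fL)) (big_morph _ (formD _ gL) (form0 gL)).
apply: eq_bigr => h _; set k := coeff h D.
have -> : << k *g h >> = k *: << h >> + 0 :> {freeg H / F}.
  by apply/eqP/freeg_eqP => x; rewrite addr0 coeffZ !coeffU mul1r.
by rewrite fL gL fc extU (form0 fL) (form0 gL).
Qed.

Definition bar_boundaries : set {freeg H / F} := [set bar_d2 c | c in setT].

Lemma bar_boundaries_lin : lin_closed bar_boundaries.
Proof.
split; first by exists 0 => //; rewrite /bar_d2 fglift0.
move=> a _ _ [c _ <-] [d _ <-]; exists (a *: c + d) => //.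
by rewrite /bar_d2 fgliftD fgliftZ.
Qed.

Lemma addhomP c : addhom c <-> (forall D, bar_boundaries D -> ext c D = 0).
Proof.
have formB (f : {freeg H / F} -> F) x y z : is_form f ->
    f (x - y + z) = f x - f y + f z.
  move=> fL; have fD u v : f (u + v) = f u + f v.
    by rewrite -[u]scale1r fL mul1r scale1r.
  have fN u : f (- u) = - f u.
    by apply: (addrI (f u)); rewrite -fD !subrr (form0 fL).
  by rewrite !fD fN.
split=> [cM _ [z _ <-]|cB g h].
  rewrite /bar_d2 -[z]freeg_sumE.
  rewrite (big_morph _ (fgliftD _) (fglift0 _)).
  have eD : {morph ext c : x y / x + y} by move=> x y; rewrite /ext fgliftD.
  rewrite (big_morph _ eD (form0 (ext_form c))) big1 // => -[g h] _.
  rewrite liftU -[X in ext c X]addr0 ext_form (form0 (ext_form c)) addr0.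
  rewrite (formB _ _ _ _ (ext_form c)) !extU /= cM.
  by rewrite [c g + _]addrC opprD addrA subrr sub0r addNr mulr0.
have : ext c (bar_d2 << (g, h) >>) = 0 by apply: cB; exists << (g, h) >>.
rewrite /bar_d2 liftU scale1r (formB _ _ _ _ (ext_form c)) !extU /= => /eqP.
by rewrite addrAC subr_eq0 addrC => /eqP.
Qed.

Lemma bar_d1_eq0 D : bar_d1 D = 0.
Proof.
rewrite /bar_d1 -[D]freeg_sumE (big_morph _ (fgliftD _) (fglift0 _)).
by rewrite big1 // => h _; rewrite liftU subrr scaler0.
Qed.

(** A matrix of values of maximal rank must have full row rank, for otherwise a
    nonzero combination of the forms kills all columns, and any point where it
    does not vanish supplies a new column that raises the rank. A right inverse of
    the matrix then gives the dual vectors. *)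
Lemma dual_vectors d (b : 'I_d -> H -> F^o) :
  (forall a : 'I_d -> F, \sum_i a i *: b i = 0 -> forall i, a i = 0) ->
  exists v : 'I_d -> {freeg H / F}, forall i j, ext (b i) (v j) = (i == j)%:R.
Proof.
move=> bI.
pose A k (z : 'I_k -> {freeg H / F}) : 'M[F]_(d, k) := \matrix_(i, j) ext (b i) (z j).
pose P r := `[< exists k (z : 'I_k -> {freeg H / F}), (r <= \rank (A k z))%N >].
have exP : exists r, P r.
  by exists 0%N; apply/asboolP; exists 0%N, (fun _ => 0).
have bP r : P r -> (r <= d)%N.
  by move=> /asboolP[k [z rA]]; exact: leq_trans rA (rank_leq_row _).
case: (ex_maxnP exP bP) => r /asboolP[k [z rA]] rmax.
have fullA : row_free (A k z).
  rewrite -kermx_eq0; apply/rowV0P => u uker; apply/eqP; apply: contraT => u0.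
  pose c : H -> F^o := \sum_i u 0 i *: b i.
  have cE h : c h = \sum_i u 0 i * b i h by rewrite /c fct_sumE.
  have [h ch] : exists h, c h != 0.
    apply: contrapT => nc; case/negP: u0; apply/eqP/rowP => i; rewrite mxE.
    apply: (bI (fun i => u 0 i)); apply/funext => h; apply/eqP.
    by apply: contraT => ch; case: nc; exists h.
  pose z' (j : 'I_(k + 1)) := match fintype.split j with inl j => z j | inr _ => << h >> end.
  have A'E : A (k + 1)%N z' = row_mx (A k z) (\col_i b i h).
    apply/matrixP => i j; rewrite !mxE /z'; case: (fintype.split j) => j'.
      by rewrite mxE.
    by rewrite extU mxE.
  have ltA : (\rank (A k z) < \rank (A (k + 1)%N z'))%N.
    have : (kermx (A (k + 1)%N z') < kermx (A k z))%MS.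
      rewrite ltmxE; apply/andP; split.
        apply/sub_kermxP; have := mulmx_ker (A (k + 1)%N z').
        by rewrite A'E mul_mx_row => /(congr1 lsubmx); rewrite row_mxKl linear0.
      apply/negP => /(submx_trans uker) /sub_kermxP.
      rewrite A'E mul_mx_row => /(congr1 rsubmx); rewrite row_mxKr linear0.
      move/matrixP/(_ 0 0); rewrite !mxE => e; case/eqP: ch; rewrite cE -[RHS]e.
      by apply: eq_bigr => i _; rewrite mxE.
    by move/rank_ltmx; rewrite !mxrank_ker; lia.
  have /rmax : P (\rank (A (k + 1)%N z')) by apply/asboolP; exists (k + 1)%N, z'.
  by rewrite leqNgt (leq_ltn_trans rA ltA).
have [B AB] := row_freeP fullA.
exists (fun l => \sum_j B j l *: z j) => i l.
rewrite (form_sum _ _ (ext_form _)); have /matrixP/(_ i l) := AB; rewrite !mxE => <-.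
by apply: eq_bigr => j _; rewrite mxE mulrC.
Qed.

Lemma basis_mod_dim d n (b : 'I_n -> {freeg H / F}) :
  is_dim addhom d -> basis_mod setT bar_boundaries b -> n = d.
Proof.
move=> dimd [_ bI bS]; have BL := bar_boundaries_lin.
apply/eqP; rewrite eqn_leq; apply/andP; split.
  have /choice[co coP] : forall z, exists a : 'I_n -> F,
      bar_boundaries (z - \sum_i a i *: b i) by move=> z; exact: (bS z I).
  have coU z a : bar_boundaries (z - \sum_i a i *: b i) -> forall i, co z i = a i.
    move=> Ba i; apply/eqP; rewrite -subr_eq0; apply/eqP.
    apply: (bI (fun i => co z i - a i)).
    under eq_bigr => j _ do rewrite scalerBl.
    rewrite sumrB; have := BL.2 (-1) _ _ (coP z) Ba.
    by rewrite scaleN1r opprB subrKA.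
  have coL i : is_form (co ^~ i).
    move=> a u v; apply: (coU _ (fun i => a * co u i + co v i)).
    under eq_bigr => j _ do rewrite scalerDl -scalerA.
    rewrite big_split /= -scaler_sumr opprD addrACA -scalerBr.
    exact: BL.2 (coP u) (coP v).
  pose c i : H -> F^o := fun h => co << h >> i.
  have coE i z : co z i = ext (c i) z by exact: (@ext_unique (c i) _ (coL i)).
  apply/dimd; exists c; split=> [i|a a0 i].
    apply/addhomP => D BD; rewrite -coE; apply: coU => //.
    by rewrite big1 ?subr0 // => j _; rewrite scale0r.
  pose s : {freeg H / F} -> F := fun z => \sum_j a j * co z j.
  have sL : is_form s.
    move=> k u v; rewrite /s mulr_sumr -big_split; apply: eq_bigr => j _ /=.
    by rewrite coL mulrDr mulrCA.
  have s0 z : s z = 0.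
    rewrite (@ext_unique 0 s sL) => [|h].
      by rewrite -(@ext_unique 0 (fun=> 0)) // => k u v; rewrite mulr0 addr0.
    have := congr1 (fun f : H -> F^o => f h) a0.
    by rewrite fct_sumE.
  rewrite -[RHS](s0 (b i)) /s (bigD1 i) //= big1 => [|j ji]; last first.
    rewrite (coU _ (fun j => (j == i)%:R)) ?(negPf ji) ?mulr0 //.
    rewrite (bigD1 i) //= eqxx scale1r big1 ?addr0 ?subrr; first exact: BL.1.
    by move=> l /negPf ->; rewrite scale0r.
  rewrite (coU _ (fun j => (j == i)%:R)) ?eqxx ?mulr1 ?addr0 //.
  rewrite (bigD1 i) //= eqxx scale1r big1 ?addr0 ?subrr; first exact: BL.1.
  by move=> l /negPf ->; rewrite scale0r.
have Xd : indep addhom d by exact/dimd.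
pose ev (j : 'I_n) c := ext c (b j).
have evL j : is_form (ev j).
  move=> a u v; rewrite /ev.
  apply/esym; apply: (@ext_unique _ (fun z => a * ext u z + ext v z)) => [k x y|h].
    rewrite !ext_form; ring.
  by rewrite !extU.
rewrite -[n]card_ord; apply: (indep_separated addhom_lin evL _ Xd) => c cM c0.
apply/funext => h; rewrite -[LHS]extU; have [a] := bS << h >> I.
move=> /((addhomP c).1 cM); have L := ext_form c.
rewrite addrC -scaleN1r L (form_sum _ _ L) big1 => [|j _]; last by rewrite [ext _ _]c0 mulr0.
by rewrite mulr0 add0r.
Qed.

(** Additive maps are the forms on H_1, and there are enough of them to detect
    every class, so that their dimension bounds that of H_1 even though H_1 is not
    known beforehand to be finite-dimensional. *)
Lemma dim_H1_addhom d : is_dim addhom d -> dim_H1 F H = d.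
Proof.
move=> dimd; have ZT : [set z : {freeg H / F} | bar_d1 z = 0] = setT.
  by apply/seteqP; split=> // z _; exact: bar_d1_eq0.
rewrite /dim_H1 ZT -/bar_boundaries /dim_mod.
case: xgetP => [n -> [b /(basis_mod_dim dimd)]//|/(_ d)[]].
have [c [cM cI]] : indep addhom d by exact/dimd.
have [v vP] := dual_vectors cI.
exists v; split=> // [a Ba i|z _].
  have := (addhomP _).1 (cM i) _ Ba; rewrite (form_sum _ _ (ext_form _)).
  rewrite (bigD1 i) //= vP eqxx mulr1 big1 ?addr0 // => j ji.
  by rewrite vP eq_sym (negPf ji) mulr0.
exists (fun i => ext (c i) z); apply: contrapT => nB.
have [f [fL fB f1]] := separating_form bar_boundaries_lin nB.
set z' := z - _ in f1 nB.
have cz' i : ext (c i) z' = 0.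
  have L := ext_form (c i); rewrite /z' addrC -scaleN1r L (form_sum _ _ L).
  rewrite (bigD1 i) //= vP eqxx mulr1 big1 ?addr0 ?mulN1r ?addNr // => j ji.
  by rewrite vP eq_sym (negPf ji) mulr0.
pose c' : H -> F^o := fun h => f << h >>.
have fE : f =1 ext c' by exact: ext_unique.
have c'M : addhom c' by apply/addhomP => D /fB; rewrite fE.
suff /dimd : indep addhom d.+1 by rewrite ltnn.
pose cc (i : 'I_d.+1) := if unlift ord0 i is Some j then c j else c'.
have cc0 : cc ord0 = c' by rewrite /cc unlift_none.
have ccS j : cc (fintype.lift ord0 j) = c j by rewrite /cc liftK.
exists cc; split=> [i|a].
  by rewrite /cc; case: unliftP.
rewrite big_ord_recl cc0; under eq_bigr => i _ do rewrite ccS.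
move=> a0; have a00 : a ord0 = 0.
  pose s z := a ord0 * ext c' z + \sum_i a (fintype.lift ord0 i) * ext (c i) z.
  have sL : is_form s.
    move=> k x y; rewrite /s ext_form; under eq_bigr => i _ do rewrite ext_form mulrDr mulrCA.
    rewrite big_split /= -mulr_sumr; ring.
  have : s z' = 0.
    rewrite (@ext_unique 0 s sL) => [|h].
      by rewrite -(@ext_unique 0 (fun=> 0)) // => k x y; rewrite mulr0 addr0.
    rewrite /s extU; under eq_bigr => i _ do rewrite extU.
    have := congr1 (fun f : H -> F^o => f h) a0.
    by move=> <-; rewrite [RHS]/GRing.add /= fct_sumE.
  by rewrite /s -fE f1 mulr1 big1 ?addr0 // => i _; rewrite cz' mulr0.
move: a0; rewrite a00 scale0r add0r => a0 i.
by case: (unliftP ord0 i) => [j ->|-> //]; exact: cI a0 j.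
Qed.

End HomologyDual.

(** * Derivations with values in sequences *)

(** The semidirect product of the sequences int -> F by the shift: homomorphisms
    into it are pairs of a homomorphism to the integers and a derivation. *)
Record seqext (F : fieldType) := SeqExt { sq : int -> F^o ; sh : int }.

Section SeqExtGroup.
Variable F : fieldType.
Implicit Types a b : seqext F.

Definition seqext_pair a := (sq a, sh a).
Definition seqext_of_pair (p : (int -> F^o) * int) := SeqExt p.1 p.2.
Lemma seqext_pairK : cancel seqext_pair seqext_of_pair. Proof. by case. Qed.

HB.instance Definition _ := Choice.copy (seqext F) (can_type seqext_pairK).

Definition seqext_one : seqext F := SeqExt 0 0.
Definition seqext_mul a b : seqext F :=
  SeqExt (fun k => sq a k + sq b (k + sh a)) (sh a + sh b).
Definition seqext_inv a : seqext F := SeqExt (fun k => - sq a (k - sh a)) (- sh a).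

Lemma seqext_eq a b : sq a =1 sq b -> sh a = sh b -> a = b.
Proof. by case: a b => u s [v s'] /= /funext -> ->. Qed.

Lemma seqext_mulA : associative seqext_mul.
Proof.
by move=> a b c; apply: seqext_eq => [k|] /=; rewrite ?addrA // [k + _ + _]addrAC.
Qed.
Lemma seqext_mul1g : left_id seqext_one seqext_mul.
Proof.
by move=> a; apply: seqext_eq => [k|] /=; rewrite ?addr0; exact: add0r.
Qed.
Lemma seqext_mulg1 : right_id seqext_one seqext_mul.
Proof. by move=> a; apply: seqext_eq => [k|] /=; rewrite addr0. Qed.
Lemma seqext_mulVg : left_inverse seqext_one seqext_inv seqext_mul.
Proof. by move=> a; apply: seqext_eq => [k|] /=; rewrite addNr. Qed.
Lemma seqext_mulgV : right_inverse seqext_one seqext_inv seqext_mul.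
Proof. by move=> a; apply: seqext_eq => [k|] /=; rewrite ?addrK subrr. Qed.

HB.instance Definition _ := isMonoid.Build (seqext F)
  seqext_mulA seqext_mul1g seqext_mulg1.
HB.instance Definition _ := hasInv.Build (seqext F) seqext_inv.
HB.instance Definition _ := Monoid_isGroup.Build (seqext F)
  seqext_mulVg seqext_mulgV.

End SeqExtGroup.

Section Derivations.
Variables (F : fieldType) (G : groupType).
Variable phi : {hom G -> Algebra.to_multiplicative int}.

Definition ph (g : G) : int := phi g.

Lemma phM g h : ph (g * h)%g = ph g + ph h.
Proof. by rewrite /ph gmulfM. Qed.
Lemma ph1 : ph 1%g = 0.
Proof. by rewrite /ph gmulf1. Qed.
Lemma phV g : ph g^-1%g = - ph g.
Proof. by rewrite /ph gmulfV. Qed.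

Variable t : G.
Hypothesis pht : ph t = 1.

Lemma ph_zpow k : ph (zpow t k) = k.
Proof.
elim/int_rect: k => [|n IHn|n IHn]; first exact: ph1.
  by rewrite -addn1 PoszD zpowD phM IHn zpow1 pht.
by rewrite -addn1 PoszD opprD zpowD phM IHn zpowN zpow1 phV pht.
Qed.

Implicit Types (d : G -> int -> F^o) (k m : int).

(** The derivations of G with values in the shift module of sequences that vanish
    at t; by restriction to the kernel of phi and evaluation at 0 they are the
    homomorphisms from that kernel to F. *)
Definition tder : set (G -> int -> F^o) :=
  [set d | (forall g h k, d (g * h)%g k = d g k + d h (k + ph g)) /\
           forall k, d t k = 0].

Lemma tder_lin : lin_closed tder.
Proof.
split; first by split=> [g h k|k] //; rewrite addr0.
move=> a u v [uM ut] [vM vt].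
have E g k : (a *: u + v) g k = a *: u g k + v g k by [].
split=> [g h k|k]; rewrite !E; last by rewrite ut vt scaler0 addr0.
by rewrite uM vM scalerDr addrACA.
Qed.

Lemma tder1 d k : tder d -> d 1%g k = 0.
Proof.
case=> dM _; apply: (addrI (d 1%g k)).
by have := dM 1%g 1%g k; rewrite ph1 !addr0 mul1g => <-.
Qed.

Lemma tderV d g k : tder d -> d g^-1%g k = - d g (k - ph g).
Proof.
move=> dT; have := tder1 k dT; rewrite -(mulVg g) dT.1 phV => /eqP.
by rewrite addr_eq0 => /eqP.
Qed.

Lemma tder_zpow d m k : tder d -> d (zpow t m) k = 0.
Proof.
move=> dT; elim/int_rect: m k => [|n IHn|n IHn] k; first exact: tder1.
  by rewrite -addn1 PoszD zpowD dT.1 IHn zpow1 dT.2 addr0.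
by rewrite -addn1 PoszD opprD zpowD dT.1 IHn zpowN zpow1 tderV // dT.2 oppr0 addr0.
Qed.

(** Hence every value of a derivation is a value at 0 on the kernel of phi. *)
Lemma tder_conj d g k m : tder d -> d (zpow t m * g * zpow t (- m - ph g))%g k = d g (k + m).
Proof.
move=> dT; rewrite dT.1 tder_zpow // addr0 dT.1 tder_zpow // add0r.
by rewrite ph_zpow.
Qed.

Lemma tder_shift d m : tder d -> tder (fun g k => d g (k + m)).
Proof.
move=> dT; split=> [g h k|k]; last exact: dT.2.
by rewrite dT.1 [k + m + _]addrAC.
Qed.

Section Presented.
Variables (n : nat) (r : seq (freegroup 'I_n)) (f : {hom freegroup 'I_n -> G}).
Hypothesis fsurj : surjective f.
Hypothesis kerf : [set w | f w = 1%g] = normal_closure [set` r].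

Local Notation x j := (f (fg_gen j)).

Lemma gen_ind (P : G -> Prop) :
  P 1%g -> (forall j, P (x j)) -> (forall g h, P g -> P h -> P (g * h)%g) ->
  (forall g, P g -> P g^-1%g) -> forall g, P g.
Proof.
move=> P1 Px PM PV g; have [w <-] := fsurj g.
elim/freegroup_ind: w => [|j|u v Pu Pv|u Pu]; first by rewrite gmulf1.
- exact: Px.
- by rewrite gmulfM; exact: PM.
- by rewrite gmulfV; exact: PV.
Qed.

Lemma tder_eq0 d : tder d -> (forall j k, d (x j) k = 0) -> d = 0.
Proof.
move=> dT dx; apply/funext => g; apply/funext => k; move: g k.
elim/gen_ind => [|j|g h dg dh|g dg] k; first exact: tder1.
- exact: dx.
- by rewrite dT.1 dg dh addr0.
- by rewrite tderV // dg oppr0.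
Qed.

Let lift_seq (c : 'I_n -> int -> F^o) : {hom freegroup 'I_n -> seqext F} :=
  fg_lift (fun j => SeqExt (c j) (ph (x j))).

Let sqM (a b : seqext F) k : sq (a * b)%g k = sq a k + sq b (k + sh a).
Proof. by []. Qed.
Let shM (a b : seqext F) : sh (a * b)%g = sh a + sh b.
Proof. by []. Qed.
Let sqV (a : seqext F) k : sq a^-1%g k = - sq a (k - sh a).
Proof. by []. Qed.

Lemma sh_lift_seq c w : sh (lift_seq c w) = ph (f w).
Proof.
elim/freegroup_ind: w => [|j|u v hu hv|u hu]; first by rewrite !gmulf1 ph1.
- by rewrite fg_lift_gen.
- by rewrite !gmulfM shM hu hv phM.
- by rewrite !gmulfV phV -hu.
Qed.

Lemma sq_lift_tder d w k : tder d -> sq (lift_seq (fun j => d (x j)) w) k = d (f w) k.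
Proof.
move=> dT; elim/freegroup_ind: w k => [|j|u v hu hv|u hu] k.
- by rewrite !gmulf1 tder1.
- by rewrite fg_lift_gen.
- by rewrite !gmulfM sqM hu hv sh_lift_seq dT.1.
- by rewrite !gmulfV sqV hu sh_lift_seq tderV.
Qed.

Let local w (L : nat) := forall c c' k,
  (forall j m, k - L%:Z <= m <= k + L%:Z -> c j m = c' j m) ->
  sq (lift_seq c w) k = sq (lift_seq c' w) k.

Let local_le w L L' : (L <= L')%N -> local w L -> local w L'.
Proof. by move=> LL' wL c c' k cc'; apply: wL => j m mk; apply: cc'; lia. Qed.

Let localP w : exists L, local w L.
Proof.
elim/freegroup_ind: w => [|j|u v [L uL] [L' vL]|u [L uL]].
- by exists 0%N => c c' k _; rewrite !gmulf1.
- by exists 0%N => c c' k cc'; rewrite !fg_lift_gen /= cc' //; lia.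
- exists (L + L' + `|ph (f u)|)%N => c c' k cc'; rewrite !gmulfM !sqM !sh_lift_seq.
  congr (_ + _); first by apply: uL => j m mk; apply: cc'; lia.
  by apply: vL => j m mk; apply: cc'; lia.
exists (L + `|ph (f u)|)%N => c c' k cc'; rewrite !gmulfV !sqV !sh_lift_seq.
by congr (- _); apply: uL => j m mk; apply: cc'; lia.
Qed.

Let local_seq (s : seq (freegroup 'I_n)) : exists L, {in s, forall w, local w L}.
Proof.
elim: s => [|w s [L sL]]; first by exists 0%N.
have [L' wL] := localP w; exists (L + L')%N => w'; rewrite inE.
case/orP => [/eqP ->|/sL]; first by apply: local_le wL; exact: leq_addl.
by apply: local_le; exact: leq_addr.
Qed.

(** This is where finite presentation enters: the finitely many relators involve
    boundedly many consecutive entries of a sequence, so that a prescription of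
    values on the generators which looks like a derivation through every window
    of a fixed length is one. *)
Lemma tder_glue : exists l : nat, forall c : 'I_n -> int -> F^o,
  (forall k, exists2 d, tder d &
     forall j m, k <= m < k + l%:Z -> d (x j) m = c j m) ->
  exists2 d, tder d & forall j m, d (x j) m = c j m.
Proof.
have [tw ftw] := fsurj t; have [L rL] := local_seq (tw :: r).
exists (2 * L + 1)%N => c cP.
have win w k : w \in tw :: r -> exists2 d, tder d & sq (lift_seq c w) k = d (f w) k.
  move=> wr; have [d dT dc] := cP (k - L%:Z); exists d => //.
  by rewrite -sq_lift_tder //; apply: rL => // j m mk; rewrite dc //; lia.
have fr w : w \in r -> f w = 1%g.
  move=> wr; have : [set w | f w = 1%g] w; last by [].
  by rewrite kerf => N _; apply.
have hr : {in r, forall w, lift_seq c w = 1%g}.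
  move=> w wr; apply: seqext_eq => [k|]; last by rewrite sh_lift_seq fr // ph1.
  have [|d dT ->] := win w k; first by rewrite inE wr orbT.
  by rewrite fr // tder1.
have [h hP] := hom_of_presentation fsurj kerf hr.
have shh g : sh (h g) = ph g by have [w <-] := fsurj g; rewrite hP sh_lift_seq.
exists (fun g => sq (h g)); last by move=> j m; rewrite hP fg_lift_gen.
split=> [g g' k|k]; first by rewrite gmulfM sqM shh.
rewrite -ftw hP; have [|d dT ->] := win tw k; first exact: mem_head.
by rewrite ftw dT.2.
Qed.

End Presented.
End Derivations.

(** * Comparing periodic and finitely supported derivations *)

Section Counting.
Variables (F : fieldType) (G : groupType).
Variable phi : {hom G -> Algebra.to_multiplicative int}.
Variable t : G.
Hypothesis pht : ph phi t = 1.
Variables (n : nat) (r : seq (freegroup 'I_n)) (f : {hom freegroup 'I_n -> G}).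
Hypothesis fsurj : surjective f.
Hypothesis kerf : [set w | f w = 1%g] = normal_closure [set` r].

Local Notation x j := (f (fg_gen j)).
Let V := G -> int -> F^o.
Implicit Types (d : V) (i l N m : nat) (k : int).

Definition supp_in (P : pred int) : set V :=
  [set d | tder phi t d /\ forall j k, ~~ P k -> d (x j) k = 0].

Definition supp N : set V := supp_in (fun k => 0 <= k < N%:Z).

Definition per i : set V :=
  [set d | tder phi t d /\ forall g k, d g (k + i%:Z) = d g k].

Lemma supp_in_lin P : lin_closed (supp_in P).
Proof.
have [T0 TL] := tder_lin F phi t.
split; first by split.
move=> a u v [uT u0] [vT v0]; split; first exact: TL.
move=> j k Pk; have -> : (a *: u + v) (x j) k = a *: u (x j) k + v (x j) k by [].
by rewrite u0 // v0 // scaler0 addr0.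
Qed.

Lemma per_lin i : lin_closed (per i).
Proof.
have [T0 TL] := tder_lin F phi t.
split; first by split.
move=> a u v [uT up] [vT vp]; split=> [|g k]; first exact: TL.
have E k' : (a *: u + v) g k' = a *: u g k' + v g k' by [].
by rewrite !E up vp.
Qed.

Lemma per_mul i d g k (q : int) : per i d -> d g (k + q * i%:Z) = d g k.
Proof.
case=> _ dp; elim/int_rect: q => [|q IHq|q IHq]; first by rewrite mul0r addr0.
  by rewrite -addn1 PoszD mulrDl mul1r addrA dp.
rewrite -[RHS]IHq -[LHS]dp -addrA; congr (d g (k + _)); lia.
Qed.

(** The second family is translated to the right of the first one. *)
Lemma supp_superadd N N' m m' :
  indep (supp N) m -> indep (supp N') m' -> indep (supp (N + N')) (m + m').
Proof.
move=> Nm N'm'.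
pose W := supp_in (fun k => N%:Z <= k < (N + N')%N%:Z).
have Wm' : indep W m'.
  apply: (indep_transfer (I := (G * int)%type) (ev := fun gk d => d gk.1 gk.2)
    (ev' := fun gk d => d gk.1 (gk.2 + N%:Z)) (supp_in_lin _) _ _ _ _ N'm') => //.
    by move=> u _ u0; apply/funext => g; apply/funext => k; exact: (u0 (g, k)).
  move=> u [uT u0]; exists (fun g k => u g (k - N%:Z)) => [|[g k]]; last by rewrite /= addrK.
  split=> [|j k Pk]; first exact: tder_shift.
  by apply: u0; apply: contra Pk; lia.
apply: (indep_sum (supp_in_lin _) (supp_in_lin _) _ _ _ Nm Wm').
- by move=> d [dT d0]; split=> // j k Pk; apply: d0; apply: contra Pk; lia.
- by move=> d [dT d0]; split=> // j k Pk; apply: d0; apply: contra Pk; lia.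
move=> u v [uT u0] [vT v0] uv0; apply: (tder_eq0 fsurj uT) => j k.
have [kN|] := boolP (0 <= k < N%:Z); last exact: u0.
have := congr1 (fun d : V => d (x j) k) uv0.
rewrite (_ : (u + v) (x j) k = u (x j) k + v (x j) k) // v0 ?addr0 //.
by lia.
Qed.

Lemma supp_bound N m : indep (supp N) m -> (m <= n * N)%N.
Proof.
move=> Nm; rewrite -[n]card_ord -[N]card_ord -card_prod.
pose ev (jk : 'I_n * 'I_N) d := d (x jk.1) (jk.2 : nat)%:Z.
apply: (indep_separated (ev := ev) (supp_in_lin _) _ _ Nm) => // u [uT u0] ev0.
apply: (tder_eq0 fsurj uT) => j k.
have [/andP[k0 kN]|] := boolP (0 <= k < N%:Z); last exact: u0.
have kN' : (`|k| < N)%N by lia.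
by have := ev0 (j, Ordinal kN'); rewrite /ev /= gez0_abs.
Qed.

Lemma indep_sub (U U' : set V) m : U `<=` U' -> indep U m -> indep U' m.
Proof. by move=> sUU' [b [Ub bI]]; exists b; split=> // i; exact/sUU'/Ub. Qed.

Section Glueing.
Variable l : nat.
Hypothesis glue : forall c : 'I_n -> int -> F^o,
  (forall k, exists2 d, tder phi t d &
     forall j k', k <= k' < k + l%:Z -> d (x j) k' = c j k') ->
  exists2 d, tder phi t d & forall j k', d (x j) k' = c j k'.
Variable i : nat.
Hypothesis li : (l <= i)%N.
Hypothesis i_gt0 : (0 < i)%N.

(** Derivations that vanish here can be repeated with period i, or cut to one
    period, without any window of length l meeting two different pieces. *)
Let gap (jk : 'I_n * 'I_l) d := d (x jk.1) ((i - l)%N%:Z + (jk.2 : nat)%:Z).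

Let card_gap : #|{: 'I_n * 'I_l}| = (n * l)%N.
Proof. by rewrite card_prod !card_ord. Qed.

Let gapP d : (forall jk, gap jk d = 0) ->
  forall j k, (i - l)%N%:Z <= k < i%:Z -> d (x j) k = 0.
Proof.
move=> d0 j k kb; have kl : (`|k - (i - l)%N%:Z| < l)%N by lia.
by rewrite -[RHS](d0 (j, Ordinal kl)) /gap /=; congr (d _ _); lia.
Qed.

Let period (jk : 'I_n * 'I_i) d := d (x jk.1) (jk.2 : nat)%:Z.

Let periodP d : (forall jk, period jk d = 0) ->
  forall j k, 0 <= k < i%:Z -> d (x j) k = 0.
Proof.
move=> d0 j k kb; have kl : (`|k| < i)%N by lia.
by rewrite -[RHS](d0 (j, Ordinal kl)) /period /=; congr (d _ _); lia.
Qed.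

Lemma supp_gap m : indep (supp i) m -> indep (supp (i - l)) (m - n * l).
Proof.
rewrite -card_gap => /(indep_cut (ev := gap) (supp_in_lin _)) cut.
apply: indep_sub (cut _) => // d [[dT d0] /gapP gap0]; split=> // j k Pk.
have [ki|] := boolP (0 <= k < i%:Z); last exact: d0.
by apply: gap0; lia.
Qed.

(** In each window of length l at most one translate of the support is visible, so
    that the periodic repetition is locally a translate of the derivation. *)
Lemma supp_per m : indep (supp (i - l)) m -> indep (per i) m.
Proof.
apply: (indep_transfer (ev := period) (ev' := period) (supp_in_lin _)) => //.
  move=> u [uT u0] /periodP up; apply: (tder_eq0 fsurj uT) => j k.
  have [ki|ki] := boolP (0 <= k < i%:Z); first exact: up.
  by apply: u0; lia.
move=> u [uT u0]; pose c j k := u (x j) (k %% i%:Z)%Z.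
have i0 : i%:Z != 0 by lia.
have [|d dT dc] := glue (c := c).
  (* q is the block that contains the last point of the window. *)
  move=> k; pose q := ((k + l%:Z - 1) %/ i%:Z)%Z.
  exists (fun g k' => u g (k' - q * i%:Z)) => [|j k' kk']; first exact: tder_shift.
  rewrite /c; set b := (k' %% i%:Z)%Z; set a := (k' %/ i%:Z)%Z.
  have k'E : k' = a * i%:Z + b by exact: divz_eq.
  have b_ge0 : 0 <= b by exact: modz_ge0.
  have b_lt : b < i%:Z by have := ltz_mod k' i0.
  have qE : k + l%:Z - 1 = q * i%:Z + ((k + l%:Z - 1) %% i%:Z)%Z by exact: divz_eq.
  have q_ge0 := modz_ge0 (k + l%:Z - 1) i0.
  have q_lt : ((k + l%:Z - 1) %% i%:Z)%Z < i%:Z by have := ltz_mod (k + l%:Z - 1) i0.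
  move: (_ %% _)%Z qE q_ge0 q_lt => e qE e_ge0 e_lt.
  have [aq|qa|aq] := ltgtP a q; last by rewrite k'E aq; congr (u _ _); lia.
    have aq1 : a * i%:Z <= (q - 1) * i%:Z by rewrite ler_wpM2r //; lia.
    have aq2 : (q - 1) * i%:Z <= a * i%:Z \/ a * i%:Z <= (q - 2) * i%:Z.
      have [|] := lerP (q - 1) a => h; [left|right]; rewrite ler_wpM2r //; lia.
    by rewrite !u0 //; lia.
  have : (q + 1) * i%:Z <= a * i%:Z by rewrite ler_wpM2r //; lia.
  by lia.
exists d => [|[j k]]; last first.
  by rewrite /period dc /c /= modz_small //; case: k => k /=; lia.
split=> // g k; apply/eqP; rewrite -subr_eq0; apply/eqP.
pose d' : V := (-1) *: d + (fun g k => d g (k + i%:Z)).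
have d'0 : d' = 0.
  apply: (tder_eq0 fsurj) => [|j k'].
    by have [_ TL] := tder_lin F phi t; apply: TL => //; exact: tder_shift.
  rewrite /d' (_ : _ k' = (-1) *: d (x j) k' + d (x j) (k' + i%:Z)) //.
  by rewrite !dc /c modzDr scaleN1r addNr.
have := congr1 (fun d : V => d g k) d'0.
rewrite /d' (_ : _ k = (-1) *: d g k + d g (k + i%:Z)) //.
by rewrite scaleN1r addrC.
Qed.

(** Thanks to the gap, each window sees either the periodic derivation or zero. *)
Lemma per_supp m : indep (per i) m -> indep (supp i) (m - n * l).
Proof.
rewrite -card_gap => /(indep_cut (ev := gap) (per_lin i)) cut.
apply: (indep_transfer (ev := period) (ev' := period) _ _ _ _ _ (cut _)) => //.
- split=> [|a u v [uT u0] [vT v0]]; first by split=> //; exact: (per_lin i).1.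
  split=> [|jk]; first exact: (per_lin i).2.
  have -> : gap jk (a *: u + v) = a *: gap jk u + gap jk v by [].
  by rewrite u0 v0 scaler0 addr0.
- move=> u [uP _] /periodP up; apply: (tder_eq0 fsurj uP.1) => j k.
  have i0 : i%:Z != 0 by lia.
  rewrite (divz_eq k i%:Z) addrC per_mul // up //.
  by have := modz_ge0 k i0; have := ltz_mod k i0; lia.
move=> u [[uT up] /gapP u0].
pose c j k := if 0 <= k < i%:Z then u (x j) k else 0.
have [k|d dT dc] := glue (c := c); last first.
  exists d => [|[j k]]; last by rewrite /period dc /c /= ltz_nat ltn_ord.
  by split=> // j k /negPf ki; rewrite dc /c ki.
have [kl|] := boolP ((k + l%:Z <= 0) || ((i - l)%N%:Z <= k)).
  exists 0 => [|j k' kk']; first exact: (tder_lin F phi t).1.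
  by rewrite /c; case: ifP => // k'i; rewrite u0 //; lia.
rewrite negb_or => kl; exists u => // j k' kk'; rewrite /c; case: ifP => // k'i.
by rewrite -up u0 //; lia.
Qed.

End Glueing.

Section Restriction.
Variable i : nat.
Let H := subgroup_of (preim_mulz phi i).

Let memH g : (g \in preim_mulz phi i) = (i%:Z %| ph phi g)%Z.
Proof. by []. Qed.

Let valHM (g h : H) : val (g * h)%g = (val g * val h)%g.
Proof. by []. Qed.

(** On phi^-1(iZ) the shifts in the derivation rule are by multiples of the period,
    so that evaluation at 0 is additive. *)
Lemma per_addhom m : indep (per i) m -> indep (@addhom F H) m.
Proof.
apply: (indep_transfer (ev := fun (h : H) (d : V) => d (val h) 0)
  (ev' := fun (h : H) (c : H -> F^o) => c h)
  (per_lin i)) => //.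
- move=> u [uT _] u0; apply/funext => g; apply/funext => k.
  rewrite -[k]add0r -(tder_conj pht) //.
  have Kg : (zpow t k * g * zpow t (- k - ph phi g))%g \in preim_mulz phi i.
    by rewrite memH !phM !(ph_zpow pht) (_ : _ + _ = 0) ?dvdz0 //; lia.
  exact: (u0 (InSubgroup Kg)).
move=> u uP; exists (fun h : H => u (val h) 0) => // g h.
rewrite valHM uP.1.1 add0r; congr (_ + _).
have /dvdzP[q ->] : (i%:Z %| ph phi (val g))%Z by rewrite -memH; exact: valP.
by rewrite -[q * _]add0r per_mul.
Qed.

(** An additive map on phi^-1(iZ) is determined by its value at t^i and by its
    restriction to the kernel of phi, which is an i-periodic derivation. *)
Lemma addhom_per m : indep (@addhom F H) m -> indep (per i) (m - 1).
Proof.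
have tiP : zpow t i%:Z \in preim_mulz phi i by rewrite memH ph_zpow.
pose ti : H := InSubgroup tiP.
rewrite -[1%N]card_unit.
move=> /(indep_cut (ev := fun (_ : unit) (c : H -> F^o) => c ti) (addhom_lin F H)) cut.
apply: (indep_transfer (ev := fun (h : H) (c : H -> F^o) => c h)
  (ev' := fun (h : H) (d : V) => d (val h) 0)
  _ _ _ _ _ (cut _)) => //.
- split=> [|a u v [uT u0] [vT v0]]; first by split=> //; exact: (addhom_lin F H).1.
  split=> [|_]; first exact: (addhom_lin F H).2.
  have -> : (a *: u + v) ti = a *: u ti + v ti by [].
  by rewrite (u0 tt) (v0 tt) scaler0 addr0.
- by move=> u _ u0; apply/funext => h.
move=> c [cM /(_ tt) cti].
have Kg g k : (zpow t k * g * zpow t (- k - ph phi g))%g \in preim_mulz phi i.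
  by rewrite memH !phM !(ph_zpow pht) (_ : _ + _ = 0) ?dvdz0 //; lia.
pose K g k : H := InSubgroup (Kg g k).
have c1 : c 1%g = 0 by apply: (addrI (c 1%g)); rewrite -cM mulg1 addr0.
have cV h : c h^-1%g = - c h.
  by apply: (addrI (c h)); rewrite -cM mulgV c1 subrr.
exists (fun g k => c (K g k)).
  split; [split=> [g h k|k]|move=> g k].
  - rewrite -cM; congr (c _); apply/val_inj; rewrite valHM /= phM.
    rewrite -!mulgA; congr (_ * (_ * _))%g; rewrite mulgA -zpowD.
    rewrite (_ : - k - ph phi g + (k + ph phi g) = 0); last by lia.
    rewrite mul1g; congr (_ * zpow t _)%g; lia.
  - rewrite -[RHS]c1; congr (c _); apply/val_inj => /=.
    by rewrite pht -[X in (_ * X * _)%g]zpow1 -!zpowD (_ : _ + _ = 0) //; lia.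
  have -> : K g (k + i%:Z) = (ti * K g k * ti^-1)%g.
    apply/val_inj; rewrite /= -zpowN.
    rewrite !mulgA -zpowD -!mulgA -zpowD [i%:Z + k]addrC.
    by congr (_ * (_ * zpow t _))%g; lia.
  by rewrite !cM cV cti oppr0 addr0 add0r.
move=> h; have /dvdzP[q hq] : (i%:Z %| ph phi (val h))%Z by rewrite -memH; exact: valP.
have -> : K (val h) 0 = (h * zpow ti (- q))%g.
  apply/val_inj; rewrite /= mul1g hq; congr (_ * _)%g.
  have valz (k : int) : val (zpow ti k) = zpow t (k * i%:Z).
    elim/int_rect: k => [|k IHk|k IHk]; first by rewrite mul0r.
      by rewrite -addn1 PoszD zpowD valHM IHk mulrDl zpowD mul1r.
    rewrite -addn1 PoszD opprD zpowD valHM IHk mulrDl zpowD zpowN /= mulN1r.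
    by rewrite zpowN.
  by rewrite valz; congr (zpow t _); lia.
rewrite cM [X in _ + X](_ : _ = 0) ?addr0 //.
elim/int_rect: (- q) => [|k IHk|k IHk]; first exact: c1.
  by rewrite -addn1 PoszD zpowD cM IHk cti addr0.
by rewrite -addn1 PoszD opprD zpowD cM IHk zpowN cV /= cti oppr0 addr0.
Qed.

End Restriction.

(** Supported and periodic derivations correspond up to the n * l conditions of
    vanishing on the gap, periodic derivations and additive maps up to the value at
    t^i; so the superadditive dimension s i of the space of derivations supported
    in [0, i) approximates the homology with bounded error. *)
Lemma homology_growth :
  exists (s : nat -> nat) (C l : nat),
  [/\ forall N N', (s N + s N' <= s (N + N'))%N,
      forall N, (s N <= n * N)%N,
      forall i, (l <= i)%N ->
        let D := dim_H1 F (subgroup_of (preim_mulz phi i)) in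
        (D <= s i + C)%N /\ (s i <= D + C)%N &
      forall N, (0 < s N)%N -> exists2 d, supp N d & d <> 0].
Proof.
have /choice[s sP] : forall N, exists D, is_dim (supp N) D.
  by move=> N; exact: dim_exists (@supp_bound N).
have [l glue] := tder_glue F pht fsurj kerf.
exists s, (n * l + 1)%N, l.+1; split=> [N N'|N|i li D|N sN].
- by apply/sP; apply: supp_superadd; exact/sP.
- by apply: supp_bound; exact/sP.
- have li' : (l <= i)%N by exact: ltnW.
  have i0 : (0 < i)%N by exact: leq_trans li.
  have up m : indep (@addhom F (subgroup_of (preim_mulz phi i))) m ->
      (m <= s i + (n * l + 1))%N.
    move=> Am; have : (m - 1 - n * l <= s i)%N; last by lia.
    by apply/sP; apply: (per_supp glue) => //; exact: addhom_per Am.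
  have [D' D'P] := dim_exists up.
  have DE : D = D' by exact: dim_H1_addhom.
  split; first by rewrite DE; exact/up/D'P.
  have : (s i - n * l <= D')%N.
    apply/D'P; apply: per_addhom; apply: (supp_per glue) => //.
    by apply: supp_gap => //; exact/sP.
  by rewrite DE; lia.
have [b [Ub bI]] : indep (supp N) 1 by exact/sP.
exists (b ord0) => // b0.
have s0 : \sum_(j < 1) (1 : F) *: b j = 0.
  by rewrite big_ord_recl big_ord0 b0 scaler0 addr0.
by have /eqP := bI (fun=> 1) s0 ord0; rewrite oner_eq0.
Qed.

End Counting.

(** * Labelled permutations *)

(** The permutational wreath product, acting on the right: a permutation of W
    together with an element of L on each arrow from w to its image. The labels of
    loops at a point form a homomorphism on the stabiliser of that point. *)
Record wreath (W : finType) (L : groupType) :=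
  Wreath { wperm : {perm W} ; wlab : {ffun W -> L} }.

Section WreathGroup.
Local Open Scope group_scope.
Variables (W : finType) (L : groupType).
Implicit Types a b : wreath W L.

Definition wreath_pair a := (wperm a, wlab a).
Definition wreath_of_pair (p : {perm W} * {ffun W -> L}) := Wreath p.1 p.2.
Lemma wreath_pairK : cancel wreath_pair wreath_of_pair. Proof. by case. Qed.

HB.instance Definition _ := Choice.copy (wreath W L) (can_type wreath_pairK).

Definition wreath_one : wreath W L := Wreath 1 [ffun=> 1].
Definition wreath_mul a b : wreath W L :=
  Wreath (wperm a * wperm b) [ffun w => wlab a w * wlab b (wperm a w)].
Definition wreath_inv a : wreath W L :=
  Wreath (wperm a)^-1 [ffun w => (wlab a ((wperm a)^-1 w))^-1].

Lemma wreath_eq a b : wperm a =1 wperm b -> wlab a =1 wlab b -> a = b.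
Proof. by case: a b => s c [s' c'] /= /permP -> /ffunP ->. Qed.

Lemma wreath_mulA : associative wreath_mul.
Proof.
by move=> a b c; apply: wreath_eq => w /=; rewrite ?ffunE ?permM ?ffunE ?mulgA.
Qed.
Lemma wreath_mul1g : left_id wreath_one wreath_mul.
Proof. by move=> a; apply: wreath_eq => w /=; rewrite ?ffunE ?mul1g ?perm1 ?ffunE ?mul1g. Qed.
Lemma wreath_mulg1 : right_id wreath_one wreath_mul.
Proof. by move=> a; apply: wreath_eq => w /=; rewrite ?ffunE ?mulg1. Qed.
Lemma wreath_mulVg : left_inverse wreath_one wreath_inv wreath_mul.
Proof. by move=> a; apply: wreath_eq => w /=; rewrite ?ffunE ?mulVg. Qed.
Lemma wreath_mulgV : right_inverse wreath_one wreath_inv wreath_mul.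
Proof. by move=> a; apply: wreath_eq => w /=; rewrite ?ffunE ?permK ?mulgV. Qed.

HB.instance Definition _ := isMonoid.Build (wreath W L)
  wreath_mulA wreath_mul1g wreath_mulg1.
HB.instance Definition _ := hasInv.Build (wreath W L) wreath_inv.
HB.instance Definition _ := Monoid_isGroup.Build (wreath W L)
  wreath_mulVg wreath_mulgV.

Lemma wpermM a b w : wperm (a * b) w = wperm b (wperm a w).
Proof. exact: permM. Qed.
Lemma wlabM a b w : wlab (a * b) w = wlab a w * wlab b (wperm a w).
Proof. exact: ffunE. Qed.
Lemma wperm1 w : wperm (1 : wreath W L) w = w.
Proof. exact: perm1. Qed.
Lemma wlab1 w : wlab (1 : wreath W L) w = 1.
Proof. exact: ffunE. Qed.

End WreathGroup.

Section LargeOfLoops.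
Local Open Scope group_scope.
Variables (W : finType) (G L : groupType) (h : {hom G -> wreath W L}) (w0 : W).

Definition loop_labels : set L :=
  [set u | exists g, wperm (h g) w0 = w0 /\ wlab (h g) w0 = u].

Lemma loop_labels1 : loop_labels 1.
Proof. by exists 1; rewrite gmulf1 wperm1 wlab1. Qed.

Lemma loop_labelsM u v : loop_labels u -> loop_labels v -> loop_labels (u * v).
Proof.
move=> [g [g0 <-]] [g' [g'0 <-]]; exists (g * g').
by rewrite gmulfM wpermM wlabM g0.
Qed.

Lemma wperm_fixV g : wperm (h g) w0 = w0 -> wperm (h g^-1) w0 = w0.
Proof.
by move=> g0; rewrite -[w in wperm _ w]g0 -wpermM -gmulfM mulgV gmulf1 wperm1.
Qed.

Lemma loop_labelsV u : loop_labels u -> loop_labels u^-1.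
Proof.
move=> [g [g0 <-]]; exists g^-1; split; first exact: wperm_fixV.
apply/esym/mulg1_eq; have := wlabM (h g) (h g^-1) w0.
by rewrite g0 -gmulfM mulgV gmulf1 wlab1 => <-.
Qed.

End LargeOfLoops.

(** The stabiliser of w0 has finite index because W is finite, and its labels form
    a homomorphism to the free group. *)
Lemma large_of_loops (W : finType) (G : groupType) (X : choiceType)
    (h : {hom G -> wreath W (freegroup X)}) (w0 : W) :
  (exists x y : freegroup X, ~ commute x y) ->
  (forall x, loop_labels h w0 (fg_gen x)) -> large G.
Proof.
move=> nab gens; pose fix0 := [set g | wperm (h g) w0 = w0].
have fix1 : fix0 1%g by rewrite /fix0 /= gmulf1 wperm1.
have fixM g g' : fix0 g -> fix0 g' -> fix0 (g * g')%g.
  by rewrite /fix0 /= gmulfM wpermM => -> ->.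
pose S := mk_subgroup fix1 fixM (@wperm_fixV _ _ _ h w0).
have SP g : g \in S <-> fix0 g by exact: mk_subgroupP.
pose lam (g : subgroup_of S) : freegroup X := wlab (h (val g)) w0.
have lamM : {morph lam : g g' / (g * g')%g}.
  move=> g g'; rewrite /lam (_ : val (g * g')%g = (val g * val g')%g) // gmulfM wlabM.
  by have /SP -> := valP g.
exists S, X, (mk_hom lamM); split=> //.
  pose C (w : W) := [set g | wperm (h g) w = w0].
  apply: (@sub_finite_set _ _ (C @` setT)); last exact/finite_image/finite_finset.
  move=> _ [g _ <-]; exists (wperm (h g^-1%g) w0) => //.
  apply/seteqP; split=> g' /=; rewrite /C /= -wpermM -gmulfM; first by move/SP.
  by move=> ?; exact/SP.
move=> u; have [g [/SP Sg <-]] : loop_labels h w0 u.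
  elim/freegroup_ind: u => [|x|u v lu lv|u lu].
  - exact: loop_labels1.
  - exact: gens.
  - exact: loop_labelsM.
  - exact: loop_labelsV.
by exists (InSubgroup Sg).
Qed.

(** * Finite lamplighter models with free labels *)

Section LamplighterModel.
Variables (F : finFieldType) (K : nat).

(** Lamps sit on a cycle of length 3K+1; the position r of the cycle stands for
    the integer r - K, so that [-K, K] is the part on which lamps are switched and
    the remaining K positions only serve to observe passing configurations. *)
Local Notation N := (3 * K).+1.
Local Notation state := {ffun 'I_N -> F}.

Definition lamp_pos (r : 'I_N) : int := (r : nat)%:Z - K%:Z.
Definition place (u : int -> F) : state := [ffun r => u (lamp_pos r)].

Definition turn (w : state) : state := [ffun r => w (ord_pred r)].
Definition unturn (w : state) : state := [ffun r => w (ordS r)].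

Lemma turnK : cancel turn unturn.
Proof. by move=> w; apply/ffunP => r; rewrite !ffunE ordSK. Qed.

(** Whatever the pattern of the lit lamps, as long as it is short it satisfies this
    at exactly one moment of its journey through the observed zone. Marking that
    moment by x makes x occur only once in the label of a full turn. *)
Definition front (w : state) : bool :=
  (w (inord (2 * K).+1) != 0) &&
  [forall r : 'I_N, ((2 * K).+1 < r)%N ==> (w r == 0)].

Definition lamps : finType := state.
Definition labels : groupType := freegroup bool.
Local Notation T := (wreath lamps labels).
Local Notation ex := (fg_gen true).
Local Notation ey := (fg_gen false).

Definition tau : T :=
  Wreath (perm (can_inj turnK) : {perm lamps})
    [ffun w : lamps => if front w then ex else ey].
Definition switch (u : int -> F) : T :=
  Wreath (perm (addIr (place u)) : {perm lamps}) [ffun=> 1%g].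

Lemma wperm_tau w : wperm tau w = turn w. Proof. exact: permE. Qed.
Lemma wlab_tau w : wlab tau w = if front w then ex else ey.
Proof. exact: ffunE. Qed.
Lemma wperm_switch u w : wperm (switch u) w = w + place u.
Proof. exact: permE. Qed.
Lemma wlab_switch u w : wlab (switch u) w = 1%g.
Proof. exact: ffunE. Qed.

Lemma placeD u v : place (fun k => u k + v k) = place u + place v.
Proof. by apply/ffunP => r; rewrite !ffunE. Qed.

Lemma switchD u v : (switch u * switch v)%g = switch (fun k => u k + v k).
Proof.
apply: wreath_eq => w; first by rewrite wpermM !wperm_switch placeD addrA.
by rewrite wlabM !wlab_switch mulg1.
Qed.

Lemma switch0 : switch (fun=> 0) = 1%g.
Proof.
apply: wreath_eq => w; last by rewrite wlab_switch.
by rewrite wperm1 wperm_switch (_ : place _ = 0) ?addr0 //; apply/ffunP => r; rewrite !ffunE.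
Qed.

Lemma switchV u : ((switch u)^-1)%g = switch (fun k => - u k).
Proof.
apply: mulg1_eq; rewrite switchD -switch0; congr switch.
by apply/funext => k; rewrite subrr.
Qed.

Lemma ord_pred_gt0 (r : 'I_N) : (0 < r)%N -> ord_pred r = r.-1 :> nat.
Proof.
move=> r0 /=; rewrite (_ : (r + N).-1 = r.-1 + N)%N; last by lia.
by rewrite modnDr modn_small //; have := ltn_ord r; lia.
Qed.

Lemma ord_pred_eq0 (r : 'I_N) : r = 0%N :> nat -> ord_pred r = (3 * K)%N :> nat.
Proof. by move=> /= ->; rewrite add0n modn_small. Qed.

(** As long as no lamp of u is observed, neither before nor after the rotation,
    the labels do not see u and the relation of the lamplighter group holds. *)
Lemma tau_switch u : (0 < K)%N -> (forall k, (K <= `|k|)%N -> u k = 0) ->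
  (tau * switch u = switch (fun k => u (k + 1)) * tau)%g.
Proof.
move=> K0 u0; apply: wreath_eq => w; rewrite ?wpermM ?wlabM ?wperm_tau !wperm_switch ?wperm_tau.
  apply/ffunP => r; rewrite !ffunE; congr (_ + _).
  have [r0|r0] := posnP (r : nat).
    by rewrite !u0 // /lamp_pos ?(ord_pred_eq0 r0) ?r0; lia.
  by congr u; rewrite /lamp_pos (ord_pred_gt0 r0); lia.
rewrite !wlab_tau !wlab_switch mulg1 mul1g; congr (if _ then _ else _).
have off (r : 'I_N) : (2 * K < r)%N -> (w + place (fun k => u (k + 1))) r = w r.
  by move=> Kr; rewrite !ffunE u0 ?addr0 // /lamp_pos; lia.
rewrite /front off; last by rewrite inordK; lia.
congr (_ && _); apply: eq_forallb => r; case: ltnP => //= Kr.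
by rewrite off //; lia.
Qed.

Lemma wperm_tauX m w : wperm (tau ^+ m)%g w = iter m turn w.
Proof.
elim: m => [|m IHm]; first exact: wperm1.
by rewrite expgSr wpermM IHm wperm_tau.
Qed.

Lemma iter_turnE m w r : (m <= N)%N ->
  iter m turn w r = w (inord ((r + (N - m)) %% N)).
Proof.
elim: m r => [|m IHm] r mN /=.
  by rewrite subn0 modnDr modn_small // inord_val.
rewrite ffunE IHm ?(ltnW mN) //; congr (w (inord _)).
rewrite /= modnDml (_ : (r + N).-1 + (N - m) = r + (N - m.+1) + N)%N ?modnDr //.
by lia.
Qed.

Lemma wlab_tauX m w : (forall j, (j < m)%N -> ~~ front (iter j turn w)) ->
  wlab (tau ^+ m)%g w = (ey ^+ m)%g.
Proof.
elim: m => [|m IHm] nf; first exact: wlab1.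
rewrite !expgSr wlabM wperm_tauX wlab_tau (negPf (nf m _)) // IHm // => j jm.
by apply: nf; exact: ltnW.
Qed.

(** The step K+1 brings the last lit lamp, which is at 0, to the first observed
    position. At any other step at which the first observed lamp is lit, the last
    lit one is less than K positions ahead, hence still in the observed zone. *)
Lemma front_iter u j : (forall k, (K <= `|k|)%N -> u k = 0) ->
  (forall k, 0 < k -> u k = 0) -> u 0 != 0 -> (j < N)%N ->
  front (iter j turn (place u)) = (j == K.+1).
Proof.
move=> uK u_gt0 u00 jN.
have K0 : (0 < K)%N.
  by case: (posnP K) => // K0; move: u00; rewrite uK ?eqxx // K0.
have placeE i : (i < N)%N -> place u (inord i) = u (i%:Z - K%:Z).
  by move=> iN; rewrite ffunE /lamp_pos inordK.
have modK (i : nat) : (i < N)%N -> ((i + N) %% N = i)%N.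
  by move=> iN; rewrite modnDr modn_small.
rewrite /front iter_turnE ?(ltnW jN) // inordK; last by lia.
set i := (_ %% N)%N; have iN : (i < N)%N by rewrite ltn_mod.
have [jK|jK] := eqVneq j K.+1.
  have iE : i = K.
    rewrite /i jK (_ : ((2 * K).+1 + (N - K.+1) = K + N)%N) ?modK //; last by lia.
    by lia.
  rewrite placeE // iE subrr u00 /=; apply/forallP => r; apply/implyP => rK.
  have rN := ltn_ord r.
  rewrite iter_turnE ?(ltnW jN) // jK.
  rewrite (_ : (r + (N - K.+1) = (r - K.+1) + N)%N); last by lia.
  by rewrite modK ?placeE ?u_gt0 //; lia.
apply/negbTE/negP => /andP[]; rewrite placeE // => ui /forallP fr.
have iK : (0 < i <= K)%N.
  by apply/andP; split; rewrite leqNgt; apply: contra ui => h;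
     [rewrite uK|rewrite u_gt0] => //; lia.
have [iK'|iK'] := eqVneq i K.
  have [lt|ge] := ltnP ((2 * K).+1 + (N - j)) N.
    by move: iK'; rewrite /i modn_small //; lia.
  move: iK'; rewrite /i (_ : (_ + _ = ((2 * K).+1 + (N - j) - N) + N)%N); last by lia.
  by rewrite modK; [move/eqP: jK; lia|lia].
(* This is where the lamp that was at 0 is now. *)
have rN : (3 * K + 1 - i < N)%N by lia.
have /implyP := fr (Ordinal rN); rewrite /= iter_turnE ?(ltnW jN) //=.
rewrite (_ : 3 * K + 1 - i + (N - j) = ((2 * K).+1 + (N - j)) + (K - i))%N; last by lia.
rewrite -modnDml -/i subnKC; last by lia.
rewrite modn_small; last by lia.
rewrite placeE; last by lia.
by rewrite subrr (negPf u00) => h; have : false by apply: h; lia.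
Qed.

Lemma full_turn u : (forall k, (K <= `|k|)%N -> u k = 0) ->
  (forall k, 0 < k -> u k = 0) -> u 0 != 0 ->
  wperm (tau ^+ N)%g (place u) = place u /\
  wlab (tau ^+ N)%g (place u) = (ey ^+ K.+1 * ex * ey ^+ (2 * K).-1)%g.
Proof.
move=> uK u_gt0 u00; have fr := front_iter uK u_gt0 u00; split.
  rewrite wperm_tauX; apply/ffunP => r; rewrite iter_turnE // subnn addn0.
  by rewrite modn_small // inord_val.
have K0 : (0 < K)%N.
  by case: (posnP K) => // K0; move: u00; rewrite uK ?eqxx // K0.
have -> : N = (K.+1 + 1 + (2 * K).-1)%N by lia.
rewrite !expgnDr expg1 !wlabM wpermM wperm_tauX wperm_tau wlab_tauX; last first.
  by move=> j jK; rewrite fr; lia.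
rewrite wlab_tau fr ?eqxx; last by lia.
congr (_ * _)%g; apply: wlab_tauX => j jK.
by rewrite -iterS -iterD fr; lia.
Qed.

End LamplighterModel.

(** * Finitely supported derivations make the group large *)

Section Largeness.
Variables (F : finFieldType) (G : groupType).
Variable phi : {hom G -> Algebra.to_multiplicative int}.
Variable t : G.
Hypothesis pht : ph phi t = 1.
Variables (n : nat) (r : seq (freegroup 'I_n)) (f : {hom freegroup 'I_n -> G}).
Hypothesis fsurj : surjective f.
Hypothesis kerf : [set w | f w = 1%g] = normal_closure [set` r].

Local Notation x j := (f (fg_gen j)).

Definition fsupp (u : int -> F) : Prop :=
  exists B : nat, forall k, (B <= `|k|)%N -> u k = 0.

Lemma fsupp_shift u s : fsupp u -> fsupp (fun k => u (k + s)).
Proof. by case=> B uB; exists (B + `|s|)%N => k kB; apply: uB; lia. Qed.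

Lemma fsuppN u : fsupp u -> fsupp (fun k => - u k).
Proof. by case=> B uB; exists B => k kB; rewrite uB ?oppr0. Qed.

Lemma fsuppD u v : fsupp u -> fsupp v -> fsupp (fun k => u k + v k).
Proof.
by case=> B uB [C vC]; exists (B + C)%N => k kB; rewrite uB ?vC ?addr0 //; lia.
Qed.

Local Notation tau_ K := (tau F K).

Lemma near_tau_switch u s : fsupp u ->
  \forall K \near \oo,
    (zpow (tau_ K) s * switch K u = switch K (fun k => u (k + s)) * zpow (tau_ K) s)%g.
Proof.
have shift1 v : fsupp v -> \forall K \near \oo,
    (tau_ K * switch K v = switch K (fun k => v (k + 1)) * tau_ K)%g.
  case=> B vB; apply: filterS2 (nbhs_infty_gt 0) (nbhs_infty_ge B) => K K0 BK.
  by apply: tau_switch => // k kK; apply: vB; exact: leq_trans kK.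
move=> us; elim/int_rect: s => [|s IHs|s IHs].
- apply: filterE => K; rewrite mul1g mulg1; congr switch.
  by apply/funext => k; rewrite addr0.
- apply: filterS2 IHs (shift1 _ (fsupp_shift s us)) => K hs h1.
  have -> : Posz s.+1 = 1 + Posz s by lia.
  rewrite !zpowD -mulgA hs mulgA !zpow1 h1 -mulgA.
  by congr (switch _ _ * _)%g; apply/funext => k; congr u; lia.
have us' : fsupp (fun k => u (k + (- Posz s - 1))) by exact: fsupp_shift.
apply: filterS2 IHs (shift1 _ us') => K hs h1.
have -> : - Posz s.+1 = - 1 + - Posz s by lia.
rewrite !zpowD -mulgA hs mulgA !(zpowN _ 1) !zpow1.
have h1' : (tau_ K * switch K (fun k => u (k + (- Posz s - 1))) =
    switch K (fun k => u (k - Posz s)) * tau_ K)%g.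
  rewrite h1; congr (switch _ _ * _)%g.
  by apply/funext => k; congr u; lia.
rewrite -[switch K (fun k => u (k - Posz s))](mulgK (tau_ K)) -h1'.
rewrite !mulgA mulVg mul1g -!mulgA; congr (switch _ _ * _)%g.
by apply/funext => k; congr u; lia.
Qed.

Variable d : G -> int -> F^o.
Hypothesis dT : tder phi t d.
Hypothesis d_gens : forall j, fsupp (d (x j)).

Lemma fsupp_tder g : fsupp (d g).
Proof.
elim/(gen_ind fsurj): g => [|j|g h gs hs|g gs]; first by exists 0%N => k _; exact: tder1 dT.
- exact: d_gens.
- have -> : d (g * h)%g = (fun k => d g k + d h (k + ph phi g)).
    by apply/funext => k; exact: dT.1.
  by apply: fsuppD => //; exact: fsupp_shift.
have -> : d g^-1%g = (fun k => - d g (k - ph phi g)).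
  by apply/funext => k; rewrite (tderV _ _ dT).
exact/fsuppN/fsupp_shift.
Qed.

Definition model_hom K : {hom freegroup 'I_n -> wreath (lamps F K) labels} :=
  fg_lift (fun j => switch K (d (x j)) * zpow (tau_ K) (ph phi (x j)))%g.

(** The evaluation of a fixed word in the lamplighter group over the integers
    involves finitely many lamps; once K exceeds their distance to 0 it takes place
    away from the observed zone, and the model performs the same computation. *)
Lemma near_model w : \forall K \near \oo,
  model_hom K w = (switch K (d (f w)) * zpow (tau_ K) (ph phi (f w)))%g.
Proof.
elim/freegroup_ind: w => [|j|u v hu hv|u hu].
- apply: filterE => K; rewrite !gmulf1 ph1 (_ : d 1%g = fun=> 0) ?switch0 ?mulg1 //.
  by apply/funext => k; exact: (tder1 _ dT).
- by apply: filterE => K; rewrite fg_lift_gen.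
- apply: filterS3 hu hv (near_tau_switch (ph phi (f u)) (fsupp_tder (f v))).
  move=> K hu hv tv; rewrite !gmulfM hu hv phM zpowD.
  rewrite mulgA -[(switch _ _ * _ * switch _ _)%g]mulgA tv !mulgA.
  rewrite switchD; congr (switch _ _ * _ * _)%g.
  by apply/funext => k; rewrite dT.1.
apply: filterS2 hu (near_tau_switch (- ph phi (f u)) (fsuppN (fsupp_tder (f u)))).
move=> K hu tu; rewrite !gmulfV hu invgM switchV -zpowN phV tu.
by congr (switch _ _ * _)%g; apply/funext => k; rewrite (tderV _ _ dT).
Qed.

Lemma near_model_relators : \forall K \near \oo, {in r, forall w, model_hom K w = 1%g}.
Proof.
have fr w : w \in r -> f w = 1%g.
  move=> wr; have : [set w | f w = 1%g] w; last by [].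
  by rewrite kerf => N _; apply.
elim: r fr => [|w s IHs] fr; first by apply: filterE => K.
have {}IHs := IHs (fun v vs => fr v (mem_behead (s := w :: s) vs)).
apply: filterS2 IHs (near_model w) => K hs hw w'; rewrite inE => /orP[/eqP ->|].
  rewrite hw fr ?mem_head // ph1 (_ : d 1%g = fun=> 0) ?switch0 ?mulg1 //.
  by apply/funext => k; exact: (tder1 _ dT).
exact: hs.
Qed.

(** Moving the last nonzero value to 0 by a power of t. *)
Lemma front_element : d <> 0 ->
  exists g, [/\ ph phi g = 0, d g 0 != 0 & forall k, 0 < k -> d g k = 0].
Proof.
move=> d0; have [g [k dgk]] : exists g k, d g k != 0.
  apply: contrapT => nd; apply: d0; apply/funext => g; apply/funext => k.
  by apply/eqP; apply: contraT => dgk; case: nd; exists g, k.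
have [B gB] := fsupp_tder g.
pose P (m : nat) := d g (m%:Z - B%:Z) != 0.
have inB k' : d g k' != 0 -> (`|k'| < B)%N.
  by move=> h; rewrite ltnNge; apply: contra h => /gB ->.
have exP : exists m, P m.
  exists `|(k + B%:Z)%R|%N; rewrite /P; have := inB _ dgk => kB.
  by rewrite (_ : _ - _ = k) //; lia.
have bP m : P m -> (m <= 2 * B)%N by move/inB; lia.
case: (ex_maxnP exP bP) => m Pm mmax.
pose s := m%:Z - B%:Z.
exists (zpow t s * g * zpow t (- s - ph phi g))%g; split.
- by rewrite !phM !(ph_zpow pht); lia.
- by rewrite (tder_conj pht) // add0r.
move=> k' k'0; rewrite (tder_conj pht) //; apply/eqP; apply: contraT => h.
have := inB _ h => hB; have : (`|(k' + s + B%:Z)%R| <= m)%N.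
  by apply: mmax; rewrite /P (_ : _ - _ = k' + s) //; rewrite /s in hB *; lia.
by rewrite /s in hB *; lia.
Qed.

Lemma freegroup_bool_nonabelian : exists a b : freegroup bool, ~ commute a b.
Proof.
exists (fg_gen true), (fg_gen false) => /(congr1 (@fgword bool)).
by [].
Qed.

(** In a large enough model, t is a loop with label y at the dark configuration,
    and switching lamps on by g, making a full turn and switching them off by g^-1
    is a loop with label y^(K+1) x y^(2K-1). *)
Lemma large_of_tder : d <> 0 -> large G.
Proof.
move=> /front_element[g [phg g0 g_gt0]].
have [wt wtE] := fsurj t; have [wg wgE] := fsurj g; have [B gB] := fsupp_tder g.
have [K0 _ HK] : \forall K \near \oo, [/\ (B <= K)%N,
    {in r, forall w, model_hom K w = 1%g},
    model_hom K wt = (switch K (d (f wt)) * zpow (tau_ K) (ph phi (f wt)))%g &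
    model_hom K wg = (switch K (d (f wg)) * zpow (tau_ K) (ph phi (f wg)))%g].
  apply: filterS2 (filterI (nbhs_infty_ge B) near_model_relators)
    (filterI (near_model wt) (near_model wg)) => K [? ?] [? ?]; by split.
have [BK kill hwt hwg] := HK K0 (leqnn K0); move: K0 BK kill hwt hwg {HK} => K BK kill hwt hwg.
have gK k : (K <= `|k|)%N -> d g k = 0.
  by move=> kK; apply: gB; exact: leq_trans kK.
have [h hP] := hom_of_presentation fsurj kerf kill.
have ht : h t = tau_ K.
  rewrite -[in LHS]wtE hP hwt wtE pht.
  rewrite (_ : d t = fun=> 0) ?switch0 ?mul1g //.
  by apply/funext => k; exact: dT.2.
have hg : h g = switch K (d g).
  by rewrite -[in LHS]wgE hP hwg wgE phg mulg1.
pose w0 : lamps F K := 0.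
have turn0 : turn (w0 : {ffun 'I_(3 * K).+1 -> F}) = w0.
  by apply/ffunP => i; rewrite !ffunE.
have tw0 : wperm (tau_ K) w0 = w0 by rewrite wperm_tau.
have tl0 : wlab (tau_ K) w0 = fg_gen false.
  by rewrite wlab_tau /front ffunE eqxx.
apply: (large_of_loops (h := h) (w0 := w0) freegroup_bool_nonabelian) => b.
have [wp wl] := full_turn (F := F) gK g_gt0 g0.
have LM := @loop_labelsM _ _ _ h w0; have LV := @loop_labelsV _ _ _ h w0.
have Ly : loop_labels h w0 (fg_gen false) by exists t; rewrite ht tw0 tl0.
have LyX m : loop_labels h w0 (fg_gen false ^+ m)%g.
  elim: m => [|m IHm]; first exact: loop_labels1.
  by rewrite expgS; exact: LM.
case: b => //.
have Lw : loop_labels h w0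
    (fg_gen false ^+ K.+1 * fg_gen true * fg_gen false ^+ (2 * K).-1)%g.
  exists (g * t ^+ (3 * K).+1 * g^-1)%g.
  have w0g : wperm (switch K (d g)) w0 = place K (d g) by rewrite wperm_switch add0r.
  have pV : wperm (h g^-1%g) (place K (d g)) = w0.
    by rewrite -w0g -hg -wpermM -gmulfM mulgV gmulf1 wperm1.
  have lV : wlab (h g^-1%g) (place K (d g)) = 1%g.
    by rewrite gmulfV hg switchV wlab_switch.
  rewrite !gmulfM !wlabM !wpermM gmulfXn ht hg w0g wp pV wl wlab_switch mul1g.
  by rewrite lV mulg1.
have -> : fg_gen true = ((fg_gen false ^+ K.+1)^-1 *
    (fg_gen false ^+ K.+1 * fg_gen true * fg_gen false ^+ (2 * K).-1) *
    (fg_gen false ^+ (2 * K).-1)^-1)%g :> freegroup bool.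
  by rewrite -!mulgA mulgV mulg1 mulKg.
by apply: (LM); [apply: (LM) => //; exact/LV|exact/LV].
Qed.

End Largeness.

(** * Limits of almost superadditive sequences *)

Section Growth.
Variables (R : realType) (s D : nat -> nat) (c C l0 : nat).
Hypothesis sD : forall a b, (s a + s b <= s (a + b))%N.
Hypothesis s_le : forall a, (s a <= c * a)%N.
Hypothesis Ds : forall i, (l0 <= i)%N -> (D i <= s i + C)%N /\ (s i <= D i + C)%N.

Let E : set R := [set (s a)%:R / a%:R | a in [set a | (0 < a)%N]].
Let l := sup E.

Let s_mul q a : (q * s a <= s (q * a))%N.
Proof.
elim: q => [|q IHq]; first by rewrite !mul0n.
by rewrite !mulSn; apply: leq_trans (sD _ _); rewrite leq_add2l.
Qed.

Let E_sup : has_sup E.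
Proof.
split; first by exists ((s 1)%:R / 1%:R); exists 1%N.
exists c%:R => _ [a a0 <-]; rewrite ler_pdivrMr ?ltr0n //.
by rewrite -natrM ler_nat.
Qed.

Let s_le_l a : (s a)%:R <= l * a%:R :> R.
Proof.
case: (posnP a) => [->|a0].
  by have := s_le 0; rewrite muln0 leqn0 mulr0 => /eqP ->.
by rewrite -ler_pdivrMr ?ltr0n //; apply: (sup_upper_bound E_sup); exists a.
Qed.

(** Fekete's argument: i contains i %/ a disjoint blocks of length a. *)
Let s_ge a i : (0 < a)%N ->
  i%:R * ((s a)%:R / a%:R) - (s a)%:R <= (s i)%:R :> R.
Proof.
move=> a0; have si : (i %/ a * s a <= s i)%N.
  apply: leq_trans (s_mul _ _) _; rewrite {2}(divn_eq i a).
  exact: leq_trans (leq_addr _ _) (sD _ _).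
apply: le_trans (_ : (i %/ a * s a)%:R <= _); last by rewrite ler_nat.
have aR : 0 < a%:R :> R by rewrite ltr0n.
have iq : i%:R <= (i %/ a).+1%:R * a%:R :> R.
  by rewrite -natrM ler_nat ltnW // ltn_ceil.
rewrite natrM lerBlDr -[X in _ <= _ + X]mul1r -mulrDl natr1 mulrA mulrAC.
by rewrite ler_wpM2r // ler_pdivrMr.
Qed.

Lemma growth_cvg : (D i)%:R / i%:R @[i --> \oo] --> l.
Proof.
apply/cvgrPdist_le => e e0; have e3 : 0 < e / 2 by rewrite divr_gt0.
have [_ [a a0 <-] la] := sup_adherent e3 E_sup.
apply: filterS3 (nbhs_infty_gt 0) (nbhs_infty_ge l0)
  (nbhs_infty_ger (2 / e * ((s a)%:R + C%:R))) => i i0 il ie.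
have iR : 0 < i%:R :> R by rewrite ltr0n.
have [up lo] := Ds il; have := s_ge i a0; have := s_le_l i.
have {}up : (D i)%:R <= (s i)%:R + C%:R :> R by rewrite -natrD ler_nat.
have {}lo : (s i)%:R <= (D i)%:R + C%:R :> R by rewrite -natrD ler_nat.
have {}ie : (s a)%:R + C%:R <= i%:R * (e / 2).
  by move: ie; rewrite -ler_pdivlMl ?divr_gt0 // invf_div mulrC.
have {}la : i%:R * l - i%:R * (e / 2) <= i%:R * ((s a)%:R / a%:R).
  by rewrite -mulrBr ler_wpM2l // ltW.
have ii : i%:R * (e / 2) + i%:R * (e / 2) = i%:R * e by rewrite -mulrDr -splitr.
have sa : 0 <= (s a)%:R :> R by [].
have C0 : 0 <= C%:R :> R by [].
have -> : l - (D i)%:R / i%:R = (l * i%:R - (D i)%:R) / i%:R.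
  by rewrite mulrBl mulfK ?gt_eqF.
rewrite normrM normfV (gtr0_norm iR) ler_pdivrMr // ler_norml.
move: la ie ii; set x := i%:R * (e / 2); set y := i%:R * (_ / _).
rewrite [i%:R * l]mulrC [i%:R * e]mulrC => la ie ii sil sy.
by apply/andP; split; lra.
Qed.

Lemma growth_pos_s : 0 < l -> exists2 a, (0 < a)%N & (0 < s a)%N.
Proof.
move=> l_gt0; have [_ [a a0 <-]] := sup_adherent l_gt0 E_sup.
rewrite subrr => sa; exists a => //; rewrite lt0n; apply: contraTneq sa => ->.
by rewrite mul0r ltxx.
Qed.

Lemma growth_pos : 0 < l <-> ~ (exists M, forall i, (0 < i)%N -> (D i <= M)%N).
Proof.
split=> [/growth_pos_s[a a0 sa] [M DM]|unb].
  pose q := (M + C + l0).+1; have := s_mul q a.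
  have qa : (q <= q * a)%N by rewrite leq_pmulr.
  have qs : (q <= q * s a)%N by rewrite leq_pmulr.
  have := DM (q * a)%N; have := Ds (i := (q * a)%N); rewrite /q in qa qs *; lia.
rewrite ltNge; apply/negP => l_le0; apply: unb.
have s0 a : s a = 0%N.
  apply/eqP; rewrite -leqn0 -(ler_nat R); apply: le_trans (s_le_l a) _.
  by rewrite mulr_le0_ge0.
exists (C + \sum_(i < l0) D i)%N => i _; have [li|il] := leqP l0 i.
  by have [+ _] := Ds li; rewrite s0; lia.
by rewrite (bigD1 (Ordinal il)) //=; lia.
Qed.

End Growth.

(** * Cyclic covers *)

Section CyclicIndex.
Variables (G : groupType) (phi : {hom G -> Algebra.to_multiplicative int}) (t : G).
Hypothesis pht : ph phi t = 1.

Lemma gindex_preim_mulz i : (0 < i)%N -> gindex (preim_mulz phi i) = i.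
Proof.
move=> i0; pose C (j : nat) : set G := [set y | (i%:Z %| ph phi y - j%:Z)%Z].
have LE : lcosets (preim_mulz phi i) = C @` `I_i.
  have in_coset g : [set y | (g^-1 * y)%g \in preim_mulz phi i] =
      [set y | (i%:Z %| ph phi y - ph phi g)%Z].
    apply/seteqP; split=> y /=; rewrite inE -/(ph phi _) phM phV addrC //.
  have iz : i%:Z != 0 by lia.
  apply/seteqP; split=> [_ [g _ <-]|_ [j _ <-]].
    exists `|(ph phi g %% i%:Z)%Z|%N.
      by have := modz_ge0 (ph phi g) iz; have := ltz_mod (ph phi g) iz; rewrite /=; lia.
    rewrite in_coset; apply/seteqP; split=> y /=; rewrite /C /= gez0_abs ?modz_ge0 //;
      rewrite -!eqz_mod_dvd modz_mod //.
  exists (zpow t j) => //; rewrite in_coset; congr (mkset _).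
  by apply/funext => y; rewrite (ph_zpow pht).
rewrite /gindex; apply: card_fset_set; rewrite LE; apply: inj_card_eq.
move=> j j' /set_mem /= ji /set_mem /= j'i Cjj'.
have : C j (zpow t j) by rewrite /C /= (ph_zpow pht) subrr dvdz0.
rewrite Cjj' /C /= (ph_zpow pht) -eqz_mod_dvd !modz_small; lia.
Qed.

End CyclicIndex.

Theorem theorem1p10 (R : realType) (G : groupType)
    (phi : {hom G -> Algebra.to_multiplicative int}) (p : nat) :
  finitely_presented G -> surjective phi -> prime p ->
  let dp i := d_ p (subgroup_of (preim_mulz phi i)) in
  let ratio i := (dp i)%:R / (gindex (preim_mulz phi i))%:R : R in
  exists l : R,
    [/\ ratio i @[i --> \oo] --> l,
        0 < l <-> ~ (exists M : nat, forall i : nat, (0 < i)%N -> (dp i <= M)%N)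
      & 0 < l -> large G].
Proof.
move=> [n [r [f [fsurj kerf]]]] phisurj _ dp ratio.
have [t pht] := phisurj (1 : int).
have [s [C [l0 [sD s_le Ds s_pos]]]] := homology_growth 'F_p pht fsurj kerf.
have {}Ds i : (l0 <= i)%N -> (dp i <= s i + C)%N /\ (s i <= dp i + C)%N by exact: Ds.
exists (sup [set ((s a)%:R / a%:R : R) | a in [set a | (0 < a)%N]]); split.
- have := growth_cvg (R := R) sD s_le Ds; apply: cvg_trans; apply: near_eq_cvg.
  apply: filterS (nbhs_infty_gt 0) => i i0.
  by rewrite /ratio (gindex_preim_mulz pht).
- exact: (growth_pos R sD s_le Ds).
move=> /(growth_pos_s s_le)[N _ /s_pos[d [dT d0] dn0]].
apply: (large_of_tder pht fsurj kerf dT _ dn0) => j.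
by exists N => k Nk; apply: d0; lia.
Qed.
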